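(* Let $M$ be a von Neumann algebra on a complex Hilbert space $H$, and let $T$ be a bijective linear map from $H$ onto a Banach space $X$ such that $\{TxT^{-1} : x\in M\}$ is a closed subalgebra of the Banach algebra $B(X)$ of all bounded linear operators on $X$. Assume that $M$ satisfies at least one of the following conditions: (1) $M$ has a cyclic vector; (2) $M$ is properly infinite; (3) $M$ is standard. Then the operator $T$ is bounded.
   Context: $T$ is everywhere defined and a priori not assumed bounded. A vector $\xi\in H$ is cyclic for $M$ if $M\xi$ is dense in $H$. A von Neumann algebra $M\subset B(H)$ is standard if there exists a bijective isometric antilinear involution $J:H\to H$ such that $JMJ=M'$ and $JzJ=z^*$ for all $z$ in the centre $Z(M)$, where $M'$ is the commutant. *)

(* Defs.v *)
From HB Require Import structures.
From mathcomp Require Import all_boot all_order all_algebra.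
From mathcomp Require Import sesquilinear complex.
From mathcomp Require Import all_classical all_reals all_analysis.
Import numFieldNormedType.Exports.
Import Order.TTheory GRing.Theory Num.Theory.

Set Implicit Arguments.
Unset Strict Implicit.
Unset Printing Implicit Defensive.

Local Open Scope classical_set_scope.
Local Open Scope complex_scope.
Local Open Scope ring_scope.

(* A complex Hilbert space is a complex Banach space whose norm comes from an
   inner product; the inner product is linear in its first argument. *)
HB.mixin Record isHilbert (R : realType) H of CompleteNormedModule R[i] H := {
  hdot : {dot H for Num.conj} ;
  sqr_norm_hdot : forall x : H, `|x| ^+ 2 = hdot x x
}.

#[short(type="hilbertType")]
HB.structure Definition Hilbert (R : realType) :=
  { H of CompleteNormedModule R[i] H & isHilbert R H }.

Section BoundedOperators.
Context {R : realType} {V W : normedModType R[i]}.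

Definition bounded_op (f : V -> W) : Prop :=
  linear f /\ exists c : R, forall x, `|f x| <= c%:C * `|x|.

(* Norms of R[i]-normed modules are R[i]-valued, hence the real part. As sup is
   0 on sets that are not bounded above, opnorm f is meaningful only when
   bounded_op f holds. *)
Definition opnorm (f : V -> W) : R :=
  sup [set complex.Re `|f x| | x in [set x | `|x| <= 1]].

End BoundedOperators.

Section OperatorAlgebras.
Context {R : realType} {V : normedModType R[i]}.
Implicit Types A : set (V -> V).

(* The sums and scalar multiples below are the pointwise ones on V -> V; the
   product of operators is composition. *)
Definition subalgebra A : Prop :=
  [/\ A `<=` bounded_op, A 0,
      (forall f g, A f -> A g -> A (f + g)),
      (forall (k : R[i]) f, A f -> A (k *: f)) &
      (forall f g, A f -> A g -> A (f \o g))].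

Definition opnorm_closed A : Prop :=
  forall f : V -> V, bounded_op f ->
    (forall e : R, 0 < e -> exists2 g, A g & opnorm (f - g) < e) -> A f.

Definition commutant A : set (V -> V) :=
  [set b | bounded_op b /\ forall a, A a -> a \o b = b \o a].

Definition center A : set (V -> V) := A `&` commutant A.

Definition cyclic_vector A (xi : V) : Prop := dense [set a xi | a in A].

End OperatorAlgebras.

Section VonNeumannAlgebras.
Context {R : realType} {H : hilbertType R}.
Implicit Types (M : set (H -> H)) (a b p q : H -> H).

Definition is_adjoint a b : Prop := forall x y, hdot (a x) y = hdot x (b y).

Definition von_neumann_algebra M : Prop :=
  [/\ subalgebra M, M idfun,
      (forall a, M a -> exists2 b, M b & is_adjoint a b) &
      commutant (commutant M) = M].

Definition projection p : Prop :=
  [/\ bounded_op p, p \o p = p & is_adjoint p p].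

(* q <= p *)
Definition subprojection q p : Prop := p \o q = q.

(* Murray-von Neumann equivalence: p = v^* v and q = v v^* for some v in M. *)
Definition mvn_equiv M p q : Prop :=
  exists v w, [/\ M v, M w, is_adjoint v w, p = w \o v & q = v \o w].

Definition finite_projection M p : Prop :=
  forall q, M q -> projection q -> subprojection q p -> mvn_equiv M p q ->
    q = p.

Definition properly_infinite M : Prop :=
  forall p, center M p -> projection p -> p <> 0 -> ~ finite_projection M p.

Definition antilinear (J : H -> H) : Prop :=
  forall (k : R[i]) x y, J (k *: x + y) = k^* *: J x + J y.

Definition standard M : Prop :=
  exists J : H -> H,
    [/\ bijective J, (forall x, `|J x| = `|x|), antilinear J & involutive J] /\
    [set J \o a \o J | a in M] = commutant M /\
    forall z, center M z -> is_adjoint z (J \o z \o J).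

End VonNeumannAlgebras.

(* Main.v *)
(* For a in M the operator T a T^-1 is bounded, one operator at a time; no uniform
   bound is needed. By closed graph, T is unbounded exactly when its separating
   space is nonzero. The elements a of M with T a bounded form a two-sided ideal,
   and the projection e onto their joint kernel is central in M; the preimage of
   the separating space lies in the range of e. So it suffices to show e = 0.
   A gliding hump shows that no infinite sequence of nonzero mutually
   annihilating idempotents of M lies under e: otherwise one could sum vectors
   h_n = p_n h_n of norm at most 2^-n with T h_n arbitrarily large compared to
   the bound of T p_n T^-1.
   If M is properly infinite and e is nonzero, then e is equivalent to a proper
   subprojection, which yields such a sequence. Otherwise finitely many vectors
   generate the range of e under M: a cyclic vector, or, in the standard case,
   because infinitely many orthogonal cyclic projections of the commutant would
   be carried into M by J. As the corner e M e is built from finitely many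
   minimal projections, it is finite dimensional, so the range of e is finite
   dimensional too; hence T e is bounded and e = 0. *)
Require Import Defs.
From mathcomp Require Import all_boot all_order all_algebra.
From mathcomp Require Import complex.
From mathcomp Require Import all_classical all_reals all_analysis.
From mathcomp Require Import sesquilinear ring lra.
Import numFieldNormedType.Exports.
Import Order.TTheory GRing.Theory Num.Theory.

Set Implicit Arguments.
Unset Strict Implicit.
Unset Printing Implicit Defensive.

Local Open Scope classical_set_scope.
Local Open Scope complex_scope.
Local Open Scope ring_scope.

(** * Real-valued norms, convergent sequences and closed subspaces *)

Section RealNorm.
Context {R : realType} {V : normedModType R[i]}.
Implicit Types (x y : V) (k : R[i]).

(* The norm of [V] is [R[i]]-valued, in a partially ordered field; estimates
   are carried out with this real-valued version. *)
Definition nrm x : R := complex.Re `|x|.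

Lemma nrmE x : `|x| = (nrm x)%:C.
Proof. by rewrite RRe_real// normr_real. Qed.

Lemma nrm_ge0 x : 0 <= nrm x.
Proof. by rewrite -ler0c -nrmE. Qed.

Lemma nrm0 : nrm 0 = 0.
Proof. by rewrite /nrm normr0. Qed.

Lemma nrm0_eq0 x : nrm x = 0 -> x = 0.
Proof. by move=> x0; apply/eqP; rewrite -normr_eq0 nrmE x0. Qed.

Lemma nrm_gt0 x : x <> 0 -> 0 < nrm x.
Proof.
by move=> x0; rewrite lt_neqAle nrm_ge0 andbT eq_sym; apply/eqP => /nrm0_eq0.
Qed.

Lemma nrmN x : nrm (- x) = nrm x.
Proof. by rewrite /nrm normrN. Qed.

Lemma nrmBC x y : nrm (x - y) = nrm (y - x).
Proof. by rewrite -opprB nrmN. Qed.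

Lemma nrmD x y : nrm (x + y) <= nrm x + nrm y.
Proof. by rewrite -lecR rmorphD /= -!nrmE ler_normD. Qed.

Lemma nrmB x y : nrm (x - y) <= nrm x + nrm y.
Proof. by rewrite (le_trans (nrmD _ _))// nrmN. Qed.

Lemma nrmZ k x : nrm (k *: x) = complex.Re `|k| * nrm x.
Proof.
by apply: complexI; rewrite rmorphM /= -!nrmE normrZ.
Qed.

Lemma nrmZr (a : R) x : 0 <= a -> nrm (a%:C *: x) = a * nrm x.
Proof. by move=> a0; rewrite nrmZ ger0_norm// ler0c. Qed.

Definition cvto (u : nat -> V) (l : V) : Prop :=
  forall e : R, 0 < e -> exists N, forall n, (N <= n)%N -> nrm (u n - l) < e.

Definition subspace (L : set V) : Prop :=
  L 0 /\ forall k x y, L x -> L y -> L (k *: x + y).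

Definition closed_subspace (L : set V) : Prop :=
  subspace L /\
  forall x, (forall e : R, 0 < e -> exists2 y, L y & nrm (x - y) < e) -> L x.

Lemma subspaceD L x y : subspace L -> L x -> L y -> L (x + y).
Proof. by case=> _ P Lx Ly; rewrite -[x]scale1r; apply: P. Qed.

Lemma subspaceZ L k x : subspace L -> L x -> L (k *: x).
Proof. by case=> L0 P Lx; rewrite -[_ *: _]addr0; apply: P. Qed.

Lemma subspaceB L x y : subspace L -> L x -> L y -> L (x - y).
Proof. by case=> _ P Lx Ly; rewrite addrC -scaleN1r; apply: P. Qed.

Lemma closed_subspace_cvto L u l : closed_subspace L ->
  (forall n, L (u n)) -> cvto u l -> L l.
Proof.
move=> [_ clL] Lu ul; apply: clL => e /ul[N uN].
by exists (u N) => //; rewrite nrmBC uN.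
Qed.

Lemma cvto_cst l : cvto (fun _ => l) l.
Proof. by move=> e e0; exists 0%N => n _; rewrite subrr nrm0. Qed.

Lemma cvto_le (u : nat -> V) l x (c : R) :
  cvto u l -> (exists N, forall n, (N <= n)%N -> nrm (u n - x) <= c) ->
  nrm (l - x) <= c.
Proof.
move=> ul [M uM]; rewrite leNgt; apply/negP => clt.
have /ul[N uN] : 0 < nrm (l - x) - c by rewrite subr_gt0.
have := uN (maxn M N) (leq_maxr _ _).
have := uM (maxn M N) (leq_maxl _ _).
have := nrmD (l - u (maxn M N)) (u (maxn M N) - x).
rewrite subrKA [nrm (l - u _)]nrmBC; lra.
Qed.

Lemma cvto_uniq u l l' : cvto u l -> cvto u l' -> l = l'.
Proof.
move=> ul ul'; apply: subr0_eq; apply: nrm0_eq0; apply/eqP.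
rewrite eq_le nrm_ge0 andbT; apply/ler_addgt0Pr => e e0; rewrite add0r.
apply: cvto_le ul _; have [N uN] := ul' _ e0.
by exists N => n /uN /ltW.
Qed.

Lemma cvtoD u v l m : cvto u l -> cvto v m -> cvto (fun n => u n + v n) (l + m).
Proof.
move=> ul vm e e0; have e20 : 0 < e / 2 by rewrite divr_gt0.
have [N uN] := ul _ e20; have [M vM] := vm _ e20.
exists (maxn N M) => n; rewrite geq_max => /andP[/uN un /vM vn].
by have := nrmD (u n - l) (v n - m); rewrite addrACA -opprD; lra.
Qed.

End RealNorm.

(** * Bounded operators between normed spaces *)

Section BoundedOperatorTheory.
Context {R : realType}.
Implicit Types U V W : normedModType R[i].

Lemma linear_op0 U V (f : U -> V) : linear f -> f 0 = 0.
Proof. by move=> lf; have := lf (-1) 0 0; rewrite !scaleN1r oppr0 addr0 addNr. Qed.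

Lemma linear_opZ U V (f : U -> V) k x : linear f -> f (k *: x) = k *: f x.
Proof. by move=> lf; have := lf k x 0; rewrite (linear_op0 lf) !addr0. Qed.

Lemma linear_opD U V (f : U -> V) x y : linear f -> f (x + y) = f x + f y.
Proof. by move=> lf; have := lf 1 x y; rewrite !scale1r. Qed.

Lemma linear_opN U V (f : U -> V) x : linear f -> f (- x) = - f x.
Proof. by move=> lf; rewrite -scaleN1r (linear_opZ _ _ lf) scaleN1r. Qed.

Lemma linear_opB U V (f : U -> V) x y : linear f -> f (x - y) = f x - f y.
Proof. by move=> lf; rewrite (linear_opD _ _ lf) (linear_opN _ lf). Qed.

(** A strictly positive constant can be divided by in the epsilon arguments below. *)
Lemma bounded_opP U V (f : U -> V) :
  bounded_op f <-> linear f /\ exists2 c : R, 0 < c & forall x, nrm (f x) <= c * nrm x.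
Proof.
split=> -[lf [c]].
  move=> fc; split=> //; exists (Num.max 1 c); first by rewrite lt_max ltr01.
  move=> x; have := fc x; rewrite !nrmE -rmorphM lecR => /le_trans; apply.
  by rewrite ler_wpM2r ?nrm_ge0// le_max lexx orbT.
by move=> c0 fc; split=> //; exists c => x; rewrite !nrmE -rmorphM lecR.
Qed.

Lemma bounded_op_cvto U V (f : U -> V) u l :
  bounded_op f -> cvto u l -> cvto (f \o u) (f l).
Proof.
move=> /bounded_opP[lf [c c0 fc]] ul e e0.
have [N uN] := ul _ (divr_gt0 e0 c0); exists N => n /uN.
by rewrite ltr_pdivlMr// mulrC /= -(linear_opB _ _ lf); apply: le_lt_trans.
Qed.

Lemma bounded_op_comp U V W (f : V -> W) (g : U -> V) :
  bounded_op f -> bounded_op g -> bounded_op (f \o g).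
Proof.
move=> /bounded_opP[lf [c c0 fc]] /bounded_opP[lg [d d0 gd]].
apply/bounded_opP; split; first by move=> k x y /=; rewrite lg lf.
exists (c * d); first exact: mulr_gt0.
move=> x /=; rewrite (le_trans (fc _))// -mulrA.
by rewrite ler_wpM2l ?gd ?ltW.
Qed.

Lemma bounded_op_scaleD U V (f g : U -> V) (k : R[i]) :
  bounded_op f -> bounded_op g -> bounded_op (fun x => k *: f x + g x).
Proof.
move=> /bounded_opP[lf [c c0 fc]] /bounded_opP[lg [d d0 gd]].
apply/bounded_opP; split.
  move=> a x y /=; rewrite lg lf !scalerDr !scalerA [k * a]mulrC.
  by rewrite addrACA.
have k0 : 0 <= complex.Re `|k| by rewrite -ler0c RRe_real// normr_real.
exists (complex.Re `|k| * c + d); first by rewrite ltr_wpDl// mulr_ge0// ltW.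
move=> x /=; rewrite (le_trans (nrmD _ _))// nrmZ mulrDl lerD// -mulrA.
by rewrite ler_wpM2l.
Qed.

Lemma bounded_op_scale U (k : R[i]) : bounded_op (fun x : U => k *: x).
Proof.
apply/bounded_opP; split; first by move=> a u v; rewrite scalerDr !scalerA mulrC.
exists (complex.Re `|k| + 1); last by move=> u; rewrite nrmZ mulrDl lerDl mul1r nrm_ge0.
by rewrite ltr_wpDl// -ler0c RRe_real// normr_real.
Qed.

Lemma bounded_op_id U : bounded_op (@idfun U).
Proof. by apply/bounded_opP; split=> //; exists 1 => // x; rewrite mul1r. Qed.

Lemma bounded_opB U V (f g : U -> V) :
  bounded_op f -> bounded_op g -> bounded_op (fun x => f x - g x).
Proof.
move=> bf bg; rewrite (_ : (fun x => _) = (fun x => (-1) *: g x + f x)).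
  exact: bounded_op_scaleD.
by apply/funext => x; rewrite scaleN1r addrC.
Qed.

Lemma bounded_op_near U V (f : U -> V) x e : bounded_op f -> 0 < e ->
  exists2 d : R, 0 < d & forall y, nrm (x - y) < d -> nrm (f x - f y) < e.
Proof.
move=> /bounded_opP[lf [c c0 fc]] e0; exists (e / c); first exact: divr_gt0.
move=> y; rewrite ltr_pdivlMr// mulrC -(linear_opB _ _ lf).
exact: le_lt_trans.
Qed.

Lemma closed_subspace_ker U V (f : U -> V) :
  bounded_op f -> closed_subspace [set x | f x = 0].
Proof.
move=> bf; have lf := bf.1; split.
  split; first exact: linear_op0.
  by move=> k x y /= fx fy; rewrite lf fx fy scaler0 addr0.
move=> x xP; apply: nrm0_eq0; apply/eqP; rewrite eq_le nrm_ge0 andbT.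
apply/ler_addgt0Pr => e e0; rewrite add0r.
have [d d0 fd] := bounded_op_near x bf e0; have [y /= fy0 /fd] := xP _ d0.
by rewrite fy0 subr0 => /ltW.
Qed.

End BoundedOperatorTheory.

(** * Completeness and sequences with summable increments *)

Lemma geometric_small {R : realType} (C e : R) : 0 < e ->
  exists N, forall n, (N <= n)%N -> C / 2 ^+ n <= e.
Proof.
move=> e0; exists (Num.truncn (`|C| / e)).+1 => n Nn.
rewrite ler_pdivrMr ?exprn_gt0// mulrC -ler_pdivrMr//.
have := @truncnS_gt _ (`|C| / e).
have nle : n%:R <= 2 ^+ n :> R by rewrite -natrX ler_nat ltnW// ltn_expl.
have := ler_nat R (Num.truncn (`|C| / e)).+1 n; rewrite Nn.
have : C / e <= `|C| / e by rewrite ler_pM2r ?invr_gt0// ler_norm.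
lra.
Qed.

Section Completeness.
Context {R : realType} {V : completeNormedModType R[i]}.

Lemma cauchy_cvto (u : nat -> V) :
  (forall e : R, 0 < e -> exists N, forall m n, (N <= m)%N -> (N <= n)%N ->
     nrm (u m - u n) < e) -> exists l, cvto u l.
Proof.
move=> uC; have cu : cvg (u @ \oo).
  apply: cauchy_cvg; apply: cauchy_exP => e e0.
  have eE : e = (complex.Re e)%:C by rewrite RRe_real// gtr0_real.
  have e0' : 0 < complex.Re e by rewrite -ltcR -eE.
  have [N uN] := uC _ e0'; exists (u N), N => // n /= Nn.
  by rewrite -ball_normE /= nrmE eE ltcR uN.
exists (lim (u @ \oo)) => e e0.
have e0' : 0 < e%:C :> R[i] by rewrite ltcR.
have [N _ uN] := (cvgrPdist_lt _ _).1 cu _ e0'; exists N => n /uN /=.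
by rewrite nrmE ltcR nrmBC.
Qed.

(** The sequence [t] is nondecreasing and bounded, so its tail is close to its supremum, and [u]
    varies no more than [t] does. The error bound follows by letting the larger index tend to
    infinity. *)
Lemma cvto_of_variation (u : nat -> V) (t : nat -> R) (B : R) :
  (forall n, nrm (u n.+1 - u n) <= t n.+1 - t n) -> (forall n, t n <= B) ->
  exists2 l, cvto u l & forall n, nrm (l - u n) <= B - t n.
Proof.
move=> ut tB; have umn n m : nrm (u (n + m)%N - u n) <= t (n + m)%N - t n.
  elim: m => [|m IH]; first by rewrite addn0 !subrr nrm0.
  rewrite addnS; have := ut (n + m)%N.
  have := nrmD (u (n + m).+1 - u (n + m)%N) (u (n + m)%N - u n).
  by rewrite subrKA; lra.
have tmn n m : t n <= t (n + m)%N by rewrite -subr_ge0 (le_trans (nrm_ge0 _) (umn _ _)).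
have tS : has_sup (range t).
  by split; [exists (t 0%N), 0%N|exists B => _ [n _ <-]].
have tsup n : t n <= sup (range t) by apply: sup_upper_bound tS _ _; exists n.
have [l ul] : exists l, cvto u l.
  apply: cauchy_cvto => e e0.
  have e20 : 0 < e / 2 by rewrite divr_gt0.
  have [_ [N _ <-] tN] := sup_adherent e20 tS.
  exists N => m n Nm Nn.
  have := umn N (m - N)%N; have := umn N (n - N)%N; rewrite !subnKC//.
  have := nrmB (u m - u N) (u n - u N); rewrite opprB addrA subrK.
  have := tsup m; have := tsup n; lra.
exists l => // n; apply: cvto_le ul _; exists n => m nm.
by have := umn n (m - n)%N; rewrite subnKC// => /le_trans; apply; rewrite lerD2r.
Qed.

Lemma cvto_of_geometric (u : nat -> V) (C : R) :
  (forall n, nrm (u n.+1 - u n) <= C / 2 ^+ n) ->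
  exists2 l, cvto u l & forall n, nrm (l - u n) <= 2 * C / 2 ^+ n.
Proof.
(* The increments of this [t] are exactly [C / 2 ^+ n]. *)
move=> uC; have [|n|l ul lu] :=
  @cvto_of_variation u (fun n => - (2 * C / 2 ^+ n)) 0.
- move=> n; rewrite (le_trans (uC n))// exprS invfM opprK.
  by have : 2 ^+ n != 0 :> R by []; set c := _ ^+ n => c0; rewrite le_eqVlt; apply/orP; left; apply/eqP; field.
- rewrite oppr_le0 divr_ge0// mulr_ge0//; have := le_trans (nrm_ge0 _) (uC 0%N).
  by rewrite expr0 divr1.
by exists l => // n; have := lu n; rewrite sub0r opprK.
Qed.

End Completeness.

(** * Inner products and their real parts *)

Section InnerProduct.
Context {R : realType} {H : hilbertType R}.
Implicit Types (x y z : H) (k : R[i]) (L : set H).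

Lemma hdotDl x y z : hdot (x + y) z = hdot x z + hdot y z.
Proof. exact: linearDl. Qed.

Lemma hdotBl x y z : hdot (x - y) z = hdot x z - hdot y z.
Proof. exact: linearBl. Qed.

Lemma hdotZl k x z : hdot (k *: x) z = k * hdot x z.
Proof. by rewrite linearZl_LR. Qed.

Lemma hdotBr x y z : hdot z (x - y) = hdot z x - hdot z y.
Proof. exact: linearBr. Qed.

Lemma hdotDr x y z : hdot z (x + y) = hdot z x + hdot z y.
Proof. exact: linearDr. Qed.

Lemma hdotZr k x z : hdot z (k *: x) = k^* * hdot z x.
Proof. by rewrite linearZr_LR. Qed.

Lemma hdot0l x : hdot 0 x = 0. Proof. exact: linear0l. Qed.

Lemma hdot0r x : hdot x 0 = 0. Proof. exact: linear0r. Qed.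

Lemma hdotC x y : hdot x y = (hdot y x)^*.
Proof. by rewrite hermC expr0 mul1r. Qed.

Lemma hdotxx x : hdot x x = (nrm x ^+ 2)%:C.
Proof. by rewrite -sqr_norm_hdot nrmE -rmorphXn. Qed.

Lemma hdotxx_eq0 x : hdot x x = 0 -> x = 0.
Proof. by move=> /eqP; rewrite dnorm_eq0 => /eqP. Qed.

Lemma hdotC0 x y : hdot x y = 0 -> hdot y x = 0.
Proof. by rewrite hdotC => /eqP; rewrite conjc_eq0 => /eqP. Qed.

Definition rdot x y : R := complex.Re (hdot x y).

Lemma rdotC x y : rdot x y = rdot y x.
Proof. by rewrite /rdot hdotC; case: (hdot y x). Qed.

Lemma rdotDl x y z : rdot (x + y) z = rdot x z + rdot y z.
Proof. by rewrite /rdot hdotDl; case: (hdot x z) => ? ?; case: (hdot y z). Qed.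

Lemma rdotBl x y z : rdot (x - y) z = rdot x z - rdot y z.
Proof. by rewrite /rdot hdotBl; case: (hdot x z) => ? ?; case: (hdot y z). Qed.

Lemma rdotDr x y z : rdot z (x + y) = rdot z x + rdot z y.
Proof. by rewrite ![rdot z _]rdotC rdotDl. Qed.

Lemma rdotBr x y z : rdot z (x - y) = rdot z x - rdot z y.
Proof. by rewrite ![rdot z _]rdotC rdotBl. Qed.

Lemma rdotZl (a : R) x z : rdot (a%:C *: x) z = a * rdot x z.
Proof. by rewrite /rdot hdotZl; case: (hdot x z) => ? ? /=; ring. Qed.

Lemma rdotZr (a : R) x z : rdot z (a%:C *: x) = a * rdot z x.
Proof. by rewrite ![rdot z _]rdotC rdotZl. Qed.

Lemma rdotxx x : rdot x x = nrm x ^+ 2.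
Proof. by rewrite /rdot hdotxx. Qed.

(** The real part of [hdot x ('i *: y)] is the imaginary part of [hdot x y]. *)
Lemma hdot_eq0 x y : rdot x y = 0 -> rdot x ('i *: y) = 0 -> hdot x y = 0.
Proof.
rewrite /rdot hdotZr; case: (hdot x y) => a b /= -> b0.
by congr (_ +i* _); move: b0 => /=; lra.
Qed.

Lemma nrm_sqrD x y : nrm (x + y) ^+ 2 = nrm x ^+ 2 + 2 * rdot x y + nrm y ^+ 2.
Proof. by rewrite -!rdotxx rdotDl !rdotDr (rdotC y x); ring. Qed.

Lemma nrm_sqrB x y : nrm (x - y) ^+ 2 = nrm x ^+ 2 - 2 * rdot x y + nrm y ^+ 2.
Proof. by rewrite -!rdotxx rdotBl !rdotBr (rdotC y x); ring. Qed.

(** Cauchy-Schwarz is read off from the triangle inequality: its square is compared with the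
    expansion of [nrm (x + y) ^+ 2]. *)
Lemma rdot_le x y : rdot x y <= nrm x * nrm y.
Proof.
have := sqr_ge0 (nrm (x + y)); have := nrmD x y; have := nrm_ge0 (x + y).
have := nrm_sqrD x y; nra.
Qed.

Lemma normr_hdot_le x y : complex.Re `|hdot x y| <= nrm x * nrm y.
Proof.
have [xy0|xy0] := eqVneq (hdot x y) 0.
  by rewrite xy0 normr0 mulr_ge0 ?nrm_ge0.
(* This factor of modulus one rotates [hdot x y] onto the nonnegative reals, which reduces the claim
   to the real estimate. *)
pose k := `|hdot x y| / hdot x y.
have -> : complex.Re `|hdot x y| = rdot (k *: x) y.
  by rewrite /rdot hdotZl /k divfK.
apply: le_trans (rdot_le _ _) _; rewrite nrmZ /k normf_div normr_id divff ?normr_eq0//.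
by rewrite mul1r.
Qed.

Lemma closed_subspace_ortho (S : set H) :
  closed_subspace [set x | forall y, S y -> hdot x y = 0].
Proof.
split.
  split; first by move=> y _; rewrite hdot0l.
  by move=> k x x' Sx Sx' y Sy; rewrite hdotDl hdotZl Sx// Sx'// mulr0 addr0.
move=> x xP y Sy; have [->|/eqP y0] := eqVneq y 0; first exact: hdot0r.
apply/eqP; rewrite -normr_eq0 -normr_le0 normr_id -[`|_|]RRe_real ?normr_real//.
rewrite (lecR _ 0).
apply/ler_addgt0Pr => e e0; rewrite add0r.
have [z /= zS xz] := xP _ (divr_gt0 e0 (nrm_gt0 y0)).
have -> : hdot x y = hdot (x - z) y by rewrite hdotBl zS// subr0.
apply: le_trans (normr_hdot_le _ _) _.
by rewrite -ler_pdivlMr ?nrm_gt0// ltW.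
Qed.

End InnerProduct.

(** * Nearest points in closed subspaces *)

Section Projection.
Context {R : realType} {H : hilbertType R}.
Implicit Types (x y z : H) (L : set H).

Lemma linear_ge0_eq0 (a b : R) : (forall t, 0 <= 2 * t * a + t ^+ 2 * b) -> a = 0.
Proof.
move=> P; have [b0|b0] := leP b 0; first by have := P a; have := P (- a); nra.
(* For [b > 0] this value of [t] minimises the quadratic. *)
have := P (- (a / b)); have -> : 2 * - (a / b) * a + (- (a / b)) ^+ 2 * b = - (a ^+ 2 / b).
  by field; rewrite gt_eqF.
rewrite oppr_ge0 pmulr_lle0 ?invr_gt0// => a2.
by apply/eqP; rewrite -sqrf_eq0 eq_le a2 sqr_ge0.
Qed.

(** A minimising sequence for the distance is Cauchy by the parallelogram law; its limit attains the
    infimum, and the first variation along [L] gives orthogonality. *)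
Lemma projection_theorem L x : closed_subspace L ->
  exists2 y, L y & forall z, L z -> hdot (x - y) z = 0.
Proof.
move=> cL; have sL := cL.1.
pose D := [set nrm (x - y) ^+ 2 | y in L]; pose d := inf D.
have D0 : has_inf D.
  split; first by exists (nrm (x - 0) ^+ 2), 0 => //; exact: sL.1.
  by exists 0 => _ [y _ <-]; rewrite sqr_ge0.
have dle y : L y -> d <= nrm (x - y) ^+ 2.
  by move=> Ly; apply: ge_inf D0.2 _ _; exists y.
(* With this accuracy, [half] bounds the squared increments of [u] by [1 / 4 ^+ n], so the
   increments are geometric. *)
have : forall n : nat, exists y, L y /\ nrm (x - y) ^+ 2 < d + 1 / 4 ^+ n.+1.
  move=> n; have e0 : 0 < 1 / 4 ^+ n.+1 :> R by rewrite divr_gt0// exprn_gt0.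
  by have [_ [y Ly <-] yd] := inf_adherent e0 D0; exists y.
move=> /choice[u uP].
(* Parallelogram law, with the distance from [x] to the midpoint of [y] and [z] bounded below by
   [d]. *)
have half y z : L y -> L z ->
    nrm (y - z) ^+ 2 <= 2 * nrm (x - y) ^+ 2 + 2 * nrm (x - z) ^+ 2 - 4 * d.
  move=> Ly Lz; have := dle _ (subspaceZ (2^-1)%:C sL (subspaceD sL Ly Lz)).
  by rewrite -!rdotxx !(rdotBl, rdotBr, rdotDl, rdotDr, rdotZl, rdotZr)
    (rdotC y x) (rdotC z x) (rdotC z y); lra.
have [|l ul _] := @cvto_of_geometric _ _ u 1.
  move=> n; rewrite -(@ler_pXn2r _ 2%N)// ?nnegrE ?nrm_ge0// ?divr_ge0//.
  have := half _ _ (uP n.+1).1 (uP n).1; have := (uP n.+1).2; have := (uP n).2.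
  rewrite expr_div_n expr1n -exprM mulnC exprM (_ : 2 ^+ 2 = 4); last by ring.
  rewrite ![4 ^+ _.+1]exprS; set c := 4 ^+ n.
  have c0 : 0 < c by rewrite exprn_gt0.
  rewrite !invfM !mul1r; have : 0 < c^-1 by rewrite invr_gt0.
  lra.
have Ll : L l by apply: closed_subspace_cvto cL _ ul => n; have [] := uP n.
have dl : nrm (x - l) ^+ 2 <= d.
  apply/ler_addgt0Pr => e e0.
  have de0 : 0 <= d + e.
    apply: addr_ge0; last exact: ltW.
    apply: lb_le_inf D0.1 _ => _ /= [y _ <-].
    by rewrite sqr_ge0.
  rewrite -(sqr_sqrtr de0) ler_pXn2r ?nnegrE ?nrm_ge0 ?sqrtr_ge0// nrmBC.
  apply: cvto_le ul _; have [N NP] := geometric_small 1 e0; exists N => n Nn.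
  rewrite nrmBC -(@ler_pXn2r _ 2%N) ?nnegrE ?nrm_ge0 ?sqrtr_ge0//.
  rewrite (sqr_sqrtr de0) (le_trans (ltW (uP n).2))// lerD2l.
  apply: le_trans (NP _ Nn); rewrite ler_pM2l// lef_pV2 ?posrE ?exprn_gt0//.
  by rewrite (@le_trans _ _ (4 ^+ n))// ?lerXn2r ?ler_weXn2l ?nnegrE//; lra.
exists l => // z Lz.
have rz w : L w -> rdot (x - l) w = 0.
  move=> Lw; apply: (@linear_ge0_eq0 _ (nrm w ^+ 2)) => t.
  have := dle _ (subspaceB sL Ll (subspaceZ t%:C sL Lw)).
  rewrite opprB addrCA addrC nrm_sqrD rdotZr -[nrm (_ *: _) ^+ 2]rdotxx rdotZl rdotZr rdotxx.
  by move: dl; lra.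
by apply: hdot_eq0; apply: rz => //; apply: subspaceZ.
Qed.

End Projection.

(** * The closed graph theorem, by a Baire-type argument *)

Section ClosedGraph.
Context {R : realType} {V W : completeNormedModType R[i]}.

(* A failing approximation at every scale yields nested balls whose common
   point has an image of norm larger than every integer. *)
Lemma approx_preimage_ball (T : V -> W) : exists n : nat, exists x0, exists2 r : R, 0 < r &
  forall x, nrm (x - x0) < r -> forall e : R, 0 < e ->
    exists y, nrm (x - y) < e /\ nrm (T y) <= n%:R.
Proof.
apply: contrapT => noball.
have step (a : nat * (V * R)) : exists b : V * R, 0 < a.2.2 ->
    [/\ nrm (b.1 - a.2.1) < a.2.2, 0 < b.2, b.2 <= a.2.2 / 2 &
      forall y, nrm (b.1 - y) <= 2 * b.2 -> a.1%:R < nrm (T y)].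
  case: a => n [x r] /=; have [r0|r0] := boolP (0 < r); last by exists (x, r).
  apply: contrapT => nob; apply: noball; exists n, x, r => // x' x'r e e0.
  (* The term [r / 2] halves the radius; [e / 4] keeps the ball of doubled radius within distance
     [e] of [x']. *)
  apply: contrapT => noy; apply: nob; exists (x', Num.min (r / 2) (e / 4)) => _ /=.
  split=> //; rewrite ?lt_min ?ge_min ?lexx ?divr_gt0// => y x'y.
  rewrite ltNge; apply/negP => Tyn; apply: noy; exists y; split=> //.
  have : Num.min (r / 2) (e / 4) <= e / 4 by rewrite ge_min lexx orbT.
  lra.
have {}[f fP] := choice step.
pose fix b n := if n is m.+1 then f (m, b m) else (0 : V, 1 : R).
have b0 n : 0 < (b n).2.
  by elim: n => [|n /= IH]; [rewrite ltr01|have [] := fP (n, b n) IH].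
(* Since the radii at least halve, the limit lies within twice the radius of each centre; hence the
   doubled radius in [step]. *)
have [n|n|l _ lb] := @cvto_of_variation _ _ (fun n => (b n).1) (fun n => - (2 * (b n).2)) 0.
- by have [/= + _ + _] := fP (n, b n) (b0 n); lra.
- by rewrite oppr_le0 mulr_ge0// ltW.
have Tl n : n%:R < nrm (T l).
  have [_ _ _] := fP (n, b n) (b0 n); apply.
  by have := lb n.+1; rewrite nrmBC sub0r opprK.
by have := Tl (Num.truncn (nrm (T l))).+1; have := @truncnS_gt _ (nrm (T l)); lra.
Qed.

(** If [y1] and [y2] approximate [x0 + s x] and [x0] in the ball found above, then [(y1 - y2) / s]
    approximates [x], and its image has norm at most [2 n / s]. *)
Lemma approx_preimage (T : V -> W) : linear T -> exists2 C : R, 0 <= C &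
  forall x e, 0 < e -> exists y, nrm (x - y) < e /\ nrm (T y) <= C * nrm x.
Proof.
move=> lT; have [n [x0 [r r0 P]]] := approx_preimage_ball T.
exists (4 * n%:R / r); first by rewrite divr_ge0 ?mulr_ge0 ?ler0n// ltW.
move=> x e e0; have [->|/eqP x0'] := eqVneq x 0.
  by exists 0; rewrite subr0 (linear_op0 lT) !nrm0 mulr0.
have nx0 := nrm_gt0 x0'.
pose s := r / (2 * nrm x); have s0 : 0 < s by rewrite divr_gt0// mulr_gt0.
have se : 0 < s * e / 2 by rewrite divr_gt0// mulr_gt0.
have [|y1 [xy1 Ty1]] := P (x0 + s%:C *: x) _ _ se.
  rewrite addrC addKr nrmZr ?ltW// /s.
  by rewrite (_ : _ * _ = r / 2); [lra|field; rewrite gt_eqF].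
have [|y2 [xy2 Ty2]] := P x0 _ _ se; first by rewrite subrr nrm0.
exists ((s^-1)%:C *: (y1 - y2)).
have sV : 0 <= s^-1 by rewrite invr_ge0 ltW.
split.
  have -> : x - (s^-1)%:C *: (y1 - y2) =
      (s^-1)%:C *: ((x0 + s%:C *: x - y1) - (x0 - y2)).
    rewrite -[x0 + _ - y1]addrA [x0 + (_ - _)]addrC addrKA opprK -addrA [- y1 + _]addrC -[y2 - _]opprB.
    by rewrite [in RHS]scalerBr scalerA -rmorphM /= mulVf ?gt_eqF// scale1r.
  rewrite nrmZr// mulrC ltr_pdivrMr// [e * s]mulrC.
  apply: le_lt_trans (nrmB _ _) _; lra.
rewrite (linear_opZ _ _ lT) nrmZr// (linear_opB _ _ lT).
have -> : 4 * n%:R / r * nrm x = s^-1 * (n%:R + n%:R).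
  by rewrite /s; field; rewrite !gt_eqF.
by rewrite ler_wpM2l// (le_trans (nrmB _ _))// lerD.
Qed.

(** The hypothesis says that the separating space of [T] is zero. Successive approximation gives
    residues [z n] of size [nrm x / 2 ^+ n] for which [T (x - z n)] converges to some [l] of norm at
    most [2 * C * nrm x]. *)
Lemma closed_graph (T : V -> W) : linear T ->
  (forall u l, cvto u 0 -> cvto (T \o u) l -> l = 0) -> bounded_op T.
Proof.
move=> lT T0; have [C C0 CP] := approx_preimage lT.
apply/bounded_opP; split=> //; exists (2 * C + 1).
  by rewrite ltr_wpDl// mulr_ge0.
move=> x; have [->|/eqP x0] := eqVneq x 0.
  by rewrite (linear_op0 lT) !nrm0 mulr0.
have nx0 := nrm_gt0 x0.
have /choice[g gP] : forall ze : V * R, exists y, 0 < ze.2 ->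
    nrm (ze.1 - y) < ze.2 /\ nrm (T y) <= C * nrm ze.1.
  by move=> [z e] /=; have [/(CP z)[y]|] := boolP (0 < e); [exists y|exists 0].
pose fix z n := if n is m.+1 then z m - g (z m, nrm x / 2 ^+ m.+1) else x.
have e0 n : 0 < nrm x / 2 ^+ n by rewrite divr_gt0// exprn_gt0.
have zP n : nrm (z n) <= nrm x / 2 ^+ n.
  case: n => [|n] /=; first by rewrite expr0 divr1.
  by have [/ltW] := gP (z n, nrm x / 2 ^+ n.+1) (e0 _).
have [n|l ul lu] := @cvto_of_geometric _ _ (fun n => T (x - z n)) (C * nrm x).
  rewrite -(linear_opB _ _ lT) /= !opprB addrC subrKA addrC subrK.
  have [_ /le_trans] := gP (z n, nrm x / 2 ^+ n.+1) (e0 _); apply=> /=.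
  by rewrite -mulrA ler_wpM2l.
have /(_ 0%N) := lu; rewrite /= subrr (linear_op0 lT) subr0 expr0 divr1 => lx.
suff -> : T x = l by rewrite mulrDl mul1r -mulrA (le_trans lx)// lerDl nrm_ge0.
(* The residues tend to [0] and [T (- z n)] tends to [l - T x], which therefore vanishes. *)
apply/esym; apply: subr0_eq; apply: (T0 (fun n => - z n)).
  move=> e ee; have [N NP] := geometric_small (2 * nrm x) ee.
  exists N => n /NP; rewrite subr0 nrmN; have := zP n; have := e0 n.
  by rewrite -mulrA; lra.
move=> e /ul[N NP]; exists N => n /NP /=.
rewrite (linear_opB _ _ lT) (linear_opN _ lT).
by rewrite opprB addrA [- _ + _]addrC.
Qed.

End ClosedGraph.

(** * A gliding hump for idempotents *)

Section GlidingHump.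
Context {R : realType} {V : completeNormedModType R[i]} {W : normedModType R[i]}.

Lemma gliding_hump (T : V -> W) (p : nat -> V -> V) (q : nat -> W -> W) :
  linear T -> (forall n, bounded_op (p n)) -> (forall n, bounded_op (q n)) ->
  (forall n x, p n (p n x) = p n x) ->
  (forall n m x, n != m -> p n (p m x) = 0) ->
  (forall n x, q n (T x) = T (p n x)) ->
  exists n, bounded_op (T \o p n).
Proof.
move=> lT bp bq pp pq qT; apply: contrapT => /forallNP nb.
have /choice[c cP] : forall n, exists c : R, 0 < c /\ forall y, nrm (q n y) <= c * nrm y.
  by move=> n; have /bounded_opP[_ [c c0 qc]] := bq n; exists c.
have /choice[h hP] : forall n, exists h, [/\ p n h = h, nrm h <= 1 / 2 ^+ n &
    n.+1%:R * c n < nrm (T h)].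
  move=> n; have /bounded_opP[lp [d d0 pd]] := bp n; have [c0 _] := cP n.
  have n0 : 0 < n.+1%:R * c n * (2 ^+ n * d) by rewrite !mulr_gt0// exprn_gt0.
  have [x xP] : exists x, n.+1%:R * c n * (2 ^+ n * d) * nrm x < nrm (T (p n x)).
    apply: contrapT => /forallNP nx; apply: (nb n); apply/bounded_opP; split.
      by move=> k x y /=; rewrite lp lT.
    by exists (n.+1%:R * c n * (2 ^+ n * d)) => // x; rewrite leNgt; apply/negP.
  have x0 : 0 < nrm x.
    apply: nrm_gt0 => x0; move: xP.
    by rewrite x0 (linear_op0 lp) (linear_op0 lT) !nrm0 mulr0 ltxx.
  have e0 : 0 < 2 ^+ n * d * nrm x by rewrite !mulr_gt0// exprn_gt0.
  have eV : 0 <= (2 ^+ n * d * nrm x)^-1 by rewrite invr_ge0 ltW.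
  (* The factor [d] offsets the bound of [p n], so that the series of the [h n] converges. *)
  exists (((2 ^+ n * d * nrm x)^-1)%:C *: p n x); split.
  - by rewrite (linear_opZ _ _ lp) pp.
  - rewrite nrmZr// mulrC ler_pdivrMr// (le_trans (pd _))// mulrA mulrA divfK//.
    by rewrite mul1r.
  - by rewrite (linear_opZ _ _ lT) nrmZr// [_^-1 * _]mulrC ltr_pdivlMr// mulrA.
pose u n := \sum_(k < n) h k.
have [n|l ul _] := @cvto_of_geometric _ _ u 1.
  by rewrite /u big_ord_recr/= addrAC subrr add0r; have [_] := hP n.
have pl m : p m l = h m.
  apply: (@cvto_uniq _ _ (p m \o u)); first exact: bounded_op_cvto.
  have pu n : p m (u n) = if (m < n)%N then h m else 0.
    elim: n => [|n IH]; first by rewrite /u big_ord0 (linear_op0 (bp m).1).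
    rewrite /u big_ord_recr/= (linear_opD _ _ (bp m).1) IH ltnS.
    have [e _ _] := hP n; rewrite -e; case: ltngtP => [mn|nm|->].
    - by rewrite pq ?addr0// ltn_eqF.
    - by rewrite pq ?addr0// gtn_eqF.
    - by rewrite add0r e e.
  by move=> e e0; exists m.+1 => n mn; rewrite /= pu mn subrr nrm0.
(* As [T (h m) = q m (T l)], its norm is at most [c m * nrm (T l)]; the factor [c m] then
   cancels. *)
have Tl m : m.+1%:R < nrm (T l).
  have [c0 qc] := cP m; have [_ _] := hP m; rewrite -pl -qT.
  by move=> /lt_le_trans/(_ (qc _)); rewrite mulrC ltr_pM2l.
by have := Tl (Num.truncn (nrm (T l))); have := @truncnS_gt _ (nrm (T l)); lra.
Qed.

End GlidingHump.

(** * Orthogonal projections, adjoints and absolute values of operators *)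

Section ProjectionOperators.
Context {R : realType} {H : hilbertType R}.
Implicit Types (x y z : H) (L : set H) (a b p : H -> H).

Lemma hdot_inj x y : (forall z, hdot x z = hdot y z) -> x = y.
Proof.
by move=> xy; apply: subr0_eq; apply: hdotxx_eq0; rewrite hdotBl xy subrr.
Qed.

Lemma hdot_injr x y : (forall z, hdot z x = hdot z y) -> x = y.
Proof. by move=> xy; apply: hdot_inj => z; rewrite hdotC xy -hdotC. Qed.

Lemma adjoint_sym a b : is_adjoint a b -> is_adjoint b a.
Proof. by move=> ab x y; rewrite hdotC -ab -hdotC. Qed.

Lemma projectionK p x : projection p -> p (p x) = p x.
Proof. by case=> _ pp _; have := congr1 (@^~ x) pp. Qed.

Definition proj_onto p L :=
  [/\ projection p, forall x, L (p x) & forall x, L x -> p x = x].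

Lemma ex_proj_onto L : closed_subspace L -> exists p, proj_onto p L.
Proof.
move=> cL; have sL := cL.1.
have /choice[p pP] : forall x, exists y, L y /\ forall z, L z -> hdot (x - y) z = 0.
  by move=> x; have [y] := projection_theorem x cL; exists y.
(* Uniqueness of the orthogonal decomposition; linearity and idempotence of [p] both follow from
   it. *)
have pu x y : L y -> (forall z, L z -> hdot (x - y) z = 0) -> p x = y.
  move=> Ly yP; have [Lp pxP] := pP x; apply: subr0_eq; apply: hdotxx_eq0.
  have Lpy : L (p x - y) by exact: subspaceB.
  have w : p x - y = (x - y) - (x - p x) by rewrite opprB [RHS]addrC subrKA.
  by rewrite {1}w hdotBl yP// pxP// subr0.
exists p; split=> [|x|x Lx]; last 2 first.
- by have [] := pP x.
- by apply: pu => // z _; rewrite subrr hdot0l.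
split.
- apply/bounded_opP; split.
    move=> k x y; have [Lx xP] := pP x; have [Ly yP] := pP y.
    apply: pu; first by apply: sL.2.
    by move=> z Lz; rewrite opprD addrACA -scalerBr hdotDl hdotZl xP// yP// mulr0 addr0.
  exists 1 => // x; rewrite mul1r -(@ler_pXn2r _ 2%N) ?nnegrE ?nrm_ge0//.
  have [Lx xP] := pP x; rewrite -{2}[x](subrK (p x)) nrm_sqrD /rdot xP//= mulr0 addr0.
  by rewrite lerDr sqr_ge0.
- apply/funext => x /=; have [Lx _] := pP x.
  by apply: pu => // z _; rewrite subrr hdot0l.
- move=> x y; have [Lx xP] := pP x; have [Ly yP] := pP y.
  rewrite -{1}[y](subrK (p y)) hdotDr (hdotC0 (yP _ Lx)) add0r.
  by rewrite -{2}[x](subrK (p x)) hdotDl xP// add0r.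
Qed.

(** Riesz representation of the functional [hdot (b x) y] of [x]: unless it is zero, a vector [w]
    orthogonal to its kernel represents it up to a scalar. *)
Lemma riesz (b : H -> H) y : bounded_op b -> exists z, forall x, hdot (b x) y = hdot x z.
Proof.
move=> bb; have lb := bb.1.
pose L := [set x | hdot (b x) y = 0].
have [L1|/existsNP[x0 x0L]] := pselect (forall x, L x).
  by exists 0 => x; rewrite hdot0r L1.
have cL : closed_subspace L.
  split.
    split; first by rewrite /L /= (linear_op0 lb) hdot0l.
    by rewrite /L => k u v /= Lu Lv; rewrite lb hdotDl hdotZl Lu Lv mulr0 addr0.
  move=> x xP; apply: ((closed_subspace_ortho [set y]).2 (b x) _ y) => // e e0.
  have [d d0 bd] := bounded_op_near x bb e0; have [u Lu /bd xu] := xP _ d0.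
  by exists (b u) => // _ ->.
have [u Lu uP] := projection_theorem x0 cL.
pose w := x0 - u; pose f x := hdot (b x) y.
have fw : f w != 0.
  by apply/eqP; rewrite /f /w (linear_opB _ _ lb) hdotBl Lu subr0.
have ww : hdot w w != 0.
  by apply/eqP => /hdotxx_eq0 w0; move: fw; rewrite w0 /f (linear_op0 lb) hdot0l eqxx.
(* The conjugate compensates for the conjugate-linearity of the second argument of [hdot]. *)
exists ((f w / hdot w w)^* *: w) => x.
have /uP/hdotC0 : L (x - (f x / f w) *: w).
  by rewrite /L /= (linear_opB _ _ lb) (linear_opZ _ _ lb) hdotBl hdotZl divfK// subrr.
rewrite hdotBl hdotZl hdotZr conjCK => /eqP; rewrite subr_eq0 => /eqP ->.
by rewrite -/w -/(f x); field; rewrite ww fw.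
Qed.

Lemma ex_adjoint b : bounded_op b -> exists2 b', bounded_op b' & is_adjoint b b'.
Proof.
move=> bb; have /choice[b' bP] := fun y => riesz y bb; exists b'; last by move=> x y.
have [lb [c c0 bc]] := (bounded_opP b).1 bb; apply/bounded_opP; split.
  move=> k x y; apply: hdot_injr => z.
  by rewrite -bP !hdotDr !hdotZr !bP.
exists c => // y; have [->|/eqP/nrm_gt0 n0] := eqVneq (b' y) 0.
  by rewrite nrm0 mulr_ge0 ?nrm_ge0// ltW.
(* The square of [nrm (b' y)] is [rdot (b (b' y)) y]; Cauchy-Schwarz applies and one factor
   cancels. *)
rewrite -(ler_pM2l n0) -expr2 -rdotxx /rdot -bP -/(rdot _ _).
rewrite (le_trans (rdot_le _ _))// mulrA [_ * c]mulrC.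
by rewrite ler_wpM2r// nrm_ge0.
Qed.

(* Invariance of [L] under the adjoint makes its orthogonal invariant. *)
Lemma proj_onto_commute p L b b' : proj_onto p L -> linear b -> is_adjoint b b' ->
  (forall x, L x -> L (b x)) -> (forall x, L x -> L (b' x)) ->
  forall x, p (b x) = b (p x).
Proof.
move=> [pp Lp pL] lb bb Lb Lb' x; have [[lp _] _ ap] := pp.
rewrite -{1}[x](subrK (p x)) (linear_opD _ _ lb) (linear_opD _ _ lp).
rewrite [p (b (p x))]pL; last exact: Lb.
rewrite (_ : p _ = 0) ?add0r//; apply: hdot_inj => z.
rewrite hdot0l ap bb -(pL (b' (p z))); last exact: Lb'.
by rewrite -ap (linear_opB _ _ lp) projectionK// subrr hdot0l.
Qed.

(* [s] plays the role of the absolute value of [c]: [1 - s] is the limit of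
   [Y_(n+1) = (1 - c^2 + Y_n^2) / 2]; the same recursion on scalars bounds the
   increments. *)
Lemma ex_abs_op c : bounded_op c -> is_adjoint c c -> (forall x, nrm (c x) <= nrm x) ->
  exists s, [/\ bounded_op s, forall x, s (s x) = c (c x),
    forall x, nrm (x - s x) <= nrm x &
    forall d, bounded_op d -> (forall x, d (c x) = c (d x)) -> forall x, d (s x) = s (d x)].
Proof.
move=> bc ac c1; have lc := bc.1.
pose h : R[i] := (2^-1)%:C.
have h2 y : h *: y + h *: y = y.
  by rewrite -scalerDl -rmorphD /= (_ : _ + _ = 1) ?scale1r//; field.
pose fix Y n x {struct n} := if n is m.+1 then h *: ((x - c (c x)) + Y m (Y m x)) else 0.
pose fix t n := if n is m.+1 then (1 + t m ^+ 2) / 2 else 0 : R.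
have b1 x : nrm (x - c (c x)) <= nrm x.
  rewrite -(@ler_pXn2r _ 2%N) ?nnegrE ?nrm_ge0// nrm_sqrB.
  have -> : rdot x (c (c x)) = nrm (c x) ^+ 2 by rewrite -rdotxx /rdot ac.
  have : nrm (c (c x)) ^+ 2 <= nrm (c x) ^+ 2 by rewrite ler_pXn2r ?nnegrE ?nrm_ge0.
  by have := sqr_ge0 (nrm (c x)); lra.
have t01 n : 0 <= t n <= 1.
  elim: n => [|n /andP[IH0 IH1]] /=; first by rewrite lexx ler01.
  by apply/andP; split; nra.
have Yl n : linear (Y n).
  elim: n => [|n IH] k x y /=; first by rewrite scaler0 addr0.
  rewrite !IH !lc (_ : k *: x + y - _ = k *: (x - c (c x)) + (y - c (c y))).
    by rewrite addrACA -scalerDr [LHS]scalerDr scalerA mulrC -scalerA.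
  by rewrite scalerBr opprD addrACA.
have hn x : nrm (h *: x) = nrm x / 2 by rewrite nrmZr ?invr_ge0// mulrC.
have Yt n x : nrm (Y n x) <= t n * nrm x.
  elim: n x => [|n IH] x /=; first by rewrite nrm0 mul0r.
  rewrite hn [_ / 2 * _]mulrAC ler_pM2r ?invr_gt0// mulrDl mul1r.
  rewrite (le_trans (nrmD _ _))// lerD// (le_trans (IH _))// expr2 -mulrA.
  by rewrite ler_wpM2l//; have /andP[] := t01 n.
have Y1 n x : nrm (Y n x) <= nrm x.
  rewrite (le_trans (Yt n x))// ler_piMl ?nrm_ge0//; by have /andP[] := t01 n.
have dY n x : nrm (Y n.+1 x - Y n x) <= t n.+1 * nrm x - t n * nrm x.
  elim: n x => [|n IH] x.
    by have := b1 x; rewrite /= addr0 subr0 expr0n addr0 mul0r subr0 hn; lra.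
  have /andP[t0 _] := t01 n; have /andP[t0' _] := t01 n.+1.
  (* The difference of squares is split as [A (A - B) + (A - B) B]; the same splitting of
     [t n.+1 ^+ 2 - t n ^+ 2] matches the bounds. *)
  have -> : Y n.+2 x - Y n.+1 x =
      h *: (Y n.+1 (Y n.+1 x - Y n x) + (Y n.+1 (Y n x) - Y n (Y n x))).
    rewrite [Y n.+2 x]/= -[h *: (_ + Y n.+1 _)]/(h *: (_ + Y n.+1 (Y n.+1 x))).
    rewrite {3}[Y n.+1 x]/= -scalerBr; congr (_ *: _).
    by rewrite (linear_opB _ _ (Yl n.+1)) subrKA opprD addrACA subrr add0r.
  have A := nrmD (Y n.+1 (Y n.+1 x - Y n x)) (Y n.+1 (Y n x) - Y n (Y n x)).
  have B := Yt n.+1 (Y n.+1 x - Y n x); have C := IH (Y n x); have D := IH x.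
  have E := Yt n x; have F := nrm_ge0 x; have G := nrm_ge0 (Y n x).
  have K : (t n.+1 - t n) * nrm (Y n x) <= (t n.+1 - t n) * (t n * nrm x).
    have := nrm_ge0 (Y n.+1 x - Y n x).
    have [x0 _|x0] := eqVneq (nrm x) 0.
      have -> : nrm (Y n x) = 0 by apply/eqP; rewrite eq_le G andbT -(mulr0 (t n)) -x0.
      by rewrite x0 !mulr0.
    have x0' : 0 < nrm x by rewrite lt_neqAle eq_sym x0 nrm_ge0.
    move=> h0; rewrite ler_wpM2l//; have := le_trans h0 D.
    by rewrite -mulrBl pmulr_lge0.
  have L : t n.+1 * nrm (Y n.+1 x - Y n x) <= t n.+1 * ((t n.+1 - t n) * nrm x).
    by rewrite ler_wpM2l// mulrBl.
  have M : t n.+1 * nrm x = (1 + t n ^+ 2) / 2 * nrm x by [].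
  rewrite hn -[t n.+2]/((1 + t n.+1 ^+ 2) / 2); move: A B C K L M.
  by move: (t n.+1) (t n) => u v; lra.
have /choice[Z ZP] : forall x, exists z, cvto (fun n => Y n x) z /\ nrm z <= nrm x.
  move=> x.
  have [|z zP z0] := cvto_of_variation (fun n => dY n x) (B := nrm x).
    by move=> n; rewrite ler_piMl ?nrm_ge0//; have /andP[] := t01 n.
  by exists z; split=> //; have := z0 0%N; rewrite /= mul0r !subr0.
have Zc x := (ZP x).1; have Z1 x := (ZP x).2.
have Zl : linear Z.
  move=> k x y; apply: cvto_uniq (Zc _) _.
  have := cvtoD (bounded_op_cvto (bounded_op_scale _ k) (Zc x)) (Zc y).
  by congr (cvto _ _); apply/funext => n; rewrite Yl.
have Zb : bounded_op Z.
  by apply/bounded_opP; split=> //; exists 1 => // x; rewrite mul1r.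
(* The limit satisfies [2 Z = 1 - c^2 + Z^2], that is [(1 - Z)^2 = c^2]. *)
have ZZ x : Z x = h *: ((x - c (c x)) + Z (Z x)).
  apply: (@cvto_uniq _ _ (fun n => Y n.+1 x)).
    by move=> e /(Zc x)[N NP]; exists N => n Nn; apply: NP; rewrite leqW.
  apply: (bounded_op_cvto (bounded_op_scale _ h)); apply: cvtoD (cvto_cst _) _.
  rewrite -[Z (Z x)]add0r.
  have Y0 : cvto (fun n => Y n (Y n x - Z x)) 0.
    move=> e /(Zc x)[N NP]; exists N => n /NP; rewrite subr0.
    exact: le_lt_trans.
  have := cvtoD Y0 (Zc (Z x)); congr (cvto _ _); apply/funext => n.
  by rewrite (linear_opB _ _ (Yl n)) subrK.
exists (fun x => x - Z x); split=> [|x|x|d bd dc x].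
- exact: bounded_opB (bounded_op_id _) Zb.
- have e : Z x + Z x = x - c (c x) + Z (Z x) by rewrite [in LHS]ZZ h2.
  rewrite (linear_opB _ _ Zl) opprB addrACA -opprD e opprD addrACA.
  by rewrite subrr addr0 subKr.
- by rewrite subKr.
have dYC n y : d (Y n y) = Y n (d y).
  elim: n y => [|n IH] y /=; first exact: (linear_op0 bd.1).
  by rewrite (linear_opZ _ _ bd.1) (linear_opD _ _ bd.1) (linear_opB _ _ bd.1) !dc !IH.
rewrite (linear_opB _ _ bd.1); congr (_ - _).
apply: cvto_uniq (bounded_op_cvto bd (Zc x)) _.
have := Zc (d x); congr (cvto _ _); apply/funext => n /=; by rewrite dYC.
Qed.

End ProjectionOperators.

(** * Projections in a von Neumann algebra and its commutant; minimal projections *)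

Section VonNeumannAlgebraTheory.
Context {R : realType} {H : hilbertType R}.
Variables (M : set (H -> H)) (hM : von_neumann_algebra M).
Implicit Types (x y z : H) (L : set H) (a b p q r e : H -> H).

Lemma vn_bounded a : M a -> bounded_op a.
Proof. by have [[bM _ _ _ _] _ _ _] := hM; apply: bM. Qed.

Lemma vn_linear a : M a -> linear a.
Proof. by case/vn_bounded. Qed.

Lemma vn_comp a b : M a -> M b -> M (a \o b).
Proof. by have [[_ _ _ _ +] _ _ _] := hM; apply. Qed.

Lemma vn_scaleD a b (k : R[i]) : M a -> M b -> M (fun x => k *: a x + b x).
Proof.
have [[_ _ MD MZ _] _ _ _] := hM => Ma Mb.
exact: (MD (k *: a) b (MZ k a Ma) Mb).
Qed.

Lemma vnB a b : M a -> M b -> M (fun x => a x - b x).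
Proof.
move=> Ma Mb; rewrite (_ : (fun x => _) = (fun x => (-1) *: b x + a x)).
  exact: vn_scaleD.
by apply/funext => x; rewrite scaleN1r addrC.
Qed.

Lemma vn_adjoint a : M a -> exists2 b, M b & is_adjoint a b.
Proof. by have [_ _ + _] := hM; apply. Qed.

Lemma commutantE a b x : M a -> commutant M b -> a (b x) = b (a x).
Proof. by move=> Ma [_ /(_ _ Ma)/(congr1 (@^~ x))]. Qed.

Lemma vn_bicommutant a : bounded_op a ->
  (forall b, commutant M b -> forall x, a (b x) = b (a x)) -> M a.
Proof.
move=> ba ab; have [_ _ _ MM] := hM; rewrite -MM; split=> // b Mb; apply/funext => x /=.
by rewrite ab.
Qed.

Lemma commutant_adjoint b : commutant M b -> exists2 b', commutant M b' & is_adjoint b b'.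
Proof.
move=> Mb; have [b' bb' ab'] := ex_adjoint Mb.1; exists b' => //; split=> // a Ma.
have [a' Ma' aa'] := vn_adjoint Ma; have aa := adjoint_sym aa'.
apply/funext => y /=; apply: hdot_injr => x.
by rewrite -aa -!ab' -commutantE// aa.
Qed.

(** The commutant is closed under adjoints, so the projection onto a subspace it leaves invariant
    commutes with it and lies in the bicommutant. *)
Lemma vn_proj_onto L : closed_subspace L ->
  (forall b x, commutant M b -> L x -> L (b x)) -> exists2 p, M p & proj_onto p L.
Proof.
move=> cL Lb; have [p pL] := ex_proj_onto cL; exists p => //.
have [[bp _ _] _ _] := pL; apply: vn_bicommutant => // b Mb x.
have [b' Mb' bb'] := commutant_adjoint Mb.
by apply: (proj_onto_commute pL Mb.1.1 bb') => y; apply: Lb.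
Qed.

Lemma commutant_proj_onto L : closed_subspace L ->
  (forall a x, M a -> L x -> L (a x)) -> exists2 p, commutant M p & proj_onto p L.
Proof.
move=> cL La; have [p pL] := ex_proj_onto cL; exists p => //.
have [[bp _ _] _ _] := pL; split=> // a Ma; have [a' Ma' aa'] := vn_adjoint Ma.
apply/funext => x /=; apply/esym.
by apply: (proj_onto_commute pL (vn_linear Ma) aa') => y; apply: La.
Qed.

Lemma subprojectionE r p x : subprojection r p -> p (r x) = r x.
Proof. by move=> /(congr1 (@^~ x)). Qed.

(** This is the adjoint of the relation [p \o r = r]. *)
Lemma subprojectionEr r p x : projection r -> projection p ->
  subprojection r p -> r (p x) = r x.
Proof.
move=> [_ _ ar] [_ _ ap] rp; apply: hdot_inj => z.
by rewrite ar ap (subprojectionE _ rp) -ar.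
Qed.

Lemma subprojection_trans q r p :
  subprojection q r -> subprojection r p -> subprojection q p.
Proof.
by move=> qr rp; apply/funext => x /=; rewrite -(subprojectionE _ qr) (subprojectionE _ rp).
Qed.

Lemma subprojectionB r p : projection r -> projection p -> subprojection r p ->
  projection (fun x => p x - r x) /\ subprojection (fun x => p x - r x) p.
Proof.
move=> pr pp rp; have [[lp _] _ ap] := pp; have [[lr _] _ ar] := pr; split; last first.
  by apply/funext => x /=; rewrite (linear_opB _ _ lp) (projectionK _ pp) (subprojectionE _ rp).
split; first by have [bp _ _] := pp; have [br _ _] := pr; exact: bounded_opB.
  apply/funext => x /=; rewrite (linear_opB _ _ lp) (linear_opB _ _ lr).
  by rewrite (projectionK _ pp) (projectionK _ pr) (subprojectionE _ rp)
    (subprojectionEr _ pr pp rp) subrr subr0.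
by move=> x y; rewrite hdotBl hdotBr ap ar.
Qed.

(** The zero projection counts as minimal. *)
Definition minimal_projection p : Prop :=
  forall r, M r -> projection r -> subprojection r p ->
    (forall x, r x = 0) \/ r = p.

(** The projection onto such an [L] belongs to [M] and lies under [p], so minimality can be applied
    directly to subspaces. *)
Lemma minimal_projection_dichotomy p L : projection p -> minimal_projection p ->
  closed_subspace L -> (forall b x, commutant M b -> L x -> L (b x)) ->
  (forall x, L x -> p x = x) ->
  (forall x, L x -> x = 0) \/ (forall x, L (p x)).
Proof.
move=> pp mp cL bL Lp; have [r Mr [pr Lr rL]] := vn_proj_onto cL bL.
have rp : subprojection r p by apply/funext => x /=; rewrite Lp.
have [r0|rE] := mp r Mr pr rp; [left=> x Lx|right=> x; rewrite -rE//].
by rewrite -(rL x Lx) r0.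
Qed.

Lemma closed_subspaceI L L' :
  closed_subspace L -> closed_subspace L' -> closed_subspace (L `&` L').
Proof.
move=> [sL cL] [sL' cL']; split.
  split; first by split; [exact: sL.1|exact: sL'.1].
  by move=> k x y [Lx L'x] [Ly L'y]; split; [exact: sL.2|exact: sL'.2].
by move=> x xP; split; [apply: cL|apply: cL'] => e /xP[y [Ly L'y] xy]; exists y.
Qed.

Lemma closed_subspace_eq (f g : H -> H) : bounded_op f -> bounded_op g ->
  closed_subspace [set x | f x = g x].
Proof.
move=> bf bg; have := closed_subspace_ker (bounded_opB bf bg).
congr (closed_subspace _); apply/funext => x; apply/propext.
by split=> [/eqP|/= ->]; rewrite ?subrr// subr_eq0 => /eqP.
Qed.

(* With [c = (a - l p) / N] and [s] the absolute value of [c], the product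
   [(s - c) (s + c)] vanishes, so that [s = c] or [s = - c] on the range of
   [p]; since [c] has a vanishing quadratic form at [x0], it kills [x0]. *)
Lemma minimal_projection_selfadjoint p a : M p -> projection p -> minimal_projection p ->
  M a -> is_adjoint a a -> (forall x, p (a x) = a x) -> (forall x, a (p x) = a x) ->
  exists k : R[i], forall x, a x = k *: p x.
Proof.
move=> Mp pp mp Ma sa pa ap; have lp := vn_linear Mp; have la := vn_linear Ma.
have [p0|/existsNP[y0 /eqP y0p]] := pselect (forall x, p x = 0).
  by exists 0 => x; rewrite scale0r -ap p0 (linear_op0 la).
pose x0 := p y0; have px0 : p x0 = x0 by rewrite projectionK.
have x00 : 0 < nrm x0 by apply: nrm_gt0; apply/eqP.
(* The Rayleigh quotient of [a] at [x0], which makes [rdot (a1 x0) x0] vanish. *)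
pose l : R := rdot (a x0) x0 / nrm x0 ^+ 2.
pose a1 x := a x - l%:C *: p x.
have Ma1 : M a1.
  rewrite (_ : a1 = fun x => (- l%:C) *: p x + a x); first exact: vn_scaleD.
  by apply/funext => x; rewrite scaleNr addrC.
have [la1 [N N0 a1N]] := (bounded_opP a1).1 (vn_bounded Ma1).
pose c x := (N^-1)%:C *: a1 x.
have NV : 0 < N^-1 by rewrite invr_gt0.
have M0 : M (fun=> 0) by have [[_ + _ _ _] _ _ _] := hM.
have Mc : M c.
  rewrite (_ : c = fun x => (N^-1)%:C *: a1 x + 0); first exact: vn_scaleD.
  by apply/funext => x; rewrite addr0.
have sc : is_adjoint c c.
  have [_ _ sp] := pp; move=> x y.
  rewrite /c /a1 hdotZl hdotZr hdotBl hdotBr hdotZl hdotZr sa sp.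
  have cr (t : R) : (t%:C)^* = t%:C :> R[i] by exact: conjc_real.
  by rewrite !cr.
have c1 x : nrm (c x) <= nrm x.
  rewrite /c (nrmZr _ (ltW NV)) (le_trans (ler_wpM2l (ltW NV) (a1N x)))//.
  by rewrite mulrA mulVf ?mul1r ?gt_eqF.
have bc := vn_bounded Mc; have lc := bc.1.
have pc x : p (c x) = c (p x).
  by rewrite /c /a1 (linear_opZ _ _ lp) (linear_opB _ _ lp) (linear_opZ _ _ lp)
    projectionK// pa ap.
have c0 : rdot (c x0) x0 = 0.
  rewrite /c rdotZl /a1 rdotBl rdotZl px0 rdotxx /l divfK ?subrr ?mulr0//.
  by rewrite sqrf_eq0 gt_eqF.
have [s [bs ss ns sC]] := ex_abs_op bc sc c1.
have ls := bs.1; have bp := vn_bounded Mp.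
have ps x : p (s x) = s (p x) by apply: sC.
have cs x : c (s x) = s (c x) by apply: sC.
have sb b x : commutant M b -> b (s x) = s (b x).
  by move=> Mb; apply: sC => [|y]; [exact: Mb.1|rewrite (commutantE _ Mc Mb)].
have cp : closed_subspace [set x | p x = x] by exact: closed_subspace_eq (bounded_op_id _).
have s0 : rdot (s x0) x0 = 0.
  (* If this subspace is zero, then [s x0 + c x0], which belongs to it because [s^2 = c^2],
     vanishes; otherwise [s x0 = c x0]. Either way [rdot (s x0) x0] is zero along with
     [rdot (c x0) x0]. *)
  pose L := [set x | s x = c x] `&` [set x | p x = x].
  have [|b x Mb [/= sx px]|x [] //|L0|Lp] := @minimal_projection_dichotomy p L pp mp.
  - by apply: closed_subspaceI => //; exact: closed_subspace_eq.
  - by split; rewrite /= ?(commutantE _ Mp Mb) ?px// -sb// sx (commutantE _ Mc Mb).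
  - have /eqP : s x0 + c x0 = 0.
      apply: L0; split => /=.
        by rewrite (linear_opD _ _ ls) (linear_opD _ _ lc) ss cs addrC.
      by rewrite (linear_opD _ _ lp) ps pc px0.
    rewrite addr_eq0 => /eqP ->; rewrite -sub0r rdotBl c0 subr0.
    by rewrite /rdot hdot0l.
  - by have [/= + _] := Lp y0; rewrite -/x0 => ->.
(* Since [s x0] is orthogonal to [x0] in the real inner product, the bound on [x0 - s x0] leaves no
   room for it. *)
have sx0 : s x0 = 0.
  have := ns x0; rewrite -(@ler_pXn2r _ 2%N) ?nnegrE ?nrm_ge0// nrm_sqrB rdotC s0.
  rewrite mulr0 subr0 gerDl => s2; apply: nrm0_eq0; apply/eqP.
  by rewrite -sqrf_eq0 eq_le s2 sqr_ge0.
have cx0 : c x0 = 0.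
  apply: hdotxx_eq0; by rewrite sc -ss sx0 (linear_op0 ls) hdot0r.
pose L := [set x | c x = 0] `&` [set x | p x = x].
have [|b x Mb [/= cx px]|x [] //|L0|Lp] := @minimal_projection_dichotomy p L pp mp.
- by apply: closed_subspaceI => //; exact: closed_subspace_ker.
- by split; rewrite /= ?(commutantE _ Mp Mb) ?px// (commutantE _ Mc Mb) cx (linear_op0 Mb.1.1).
- by move: x00; rewrite (L0 x0) ?nrm0 ?ltxx.
exists l%:C => x; have [/= + _] := Lp x; rewrite /c /a1 => /eqP.
rewrite scaler_eq0 ap projectionK// subr_eq0 => /orP[|/eqP//].
by rewrite (inj_eq (@complexI _) _ 0) gt_eqF.
Qed.

(** Both [u = a + a'] and [v = - 'i (a - a')] are self-adjoint in the corner and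
    [a = (u + 'i v) / 2], so the self-adjoint case applies to each. *)
Lemma minimal_projection_corner p a : M p -> projection p -> minimal_projection p ->
  M a -> (forall x, p (a x) = a x) -> (forall x, a (p x) = a x) ->
  exists k : R[i], forall x, a x = k *: p x.
Proof.
move=> Mp pp mp Ma pa ap; have [a' Ma' aa'] := vn_adjoint Ma.
have [_ _ sp] := pp; have a'a := adjoint_sym aa'.
have pa' x : p (a' x) = a' x by apply: hdot_injr => z; rewrite -sp -!aa' ap.
have ap' x : a' (p x) = a' x by apply: hdot_injr => z; rewrite -!aa' -sp pa.
have lp := vn_linear Mp.
pose u x := 1 *: a x + a' x.
pose v x := (- 'i) *: a x + 'i *: a' x.
have [k1 k1P] : exists k : R[i], forall x, u x = k *: p x.
  apply: minimal_projection_selfadjoint => //.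
  - exact: vn_scaleD.
  - by move=> x y; rewrite /u !scale1r hdotDl hdotDr aa' a'a addrC.
  - by move=> x; rewrite /u (lp) pa pa'.
  - by move=> x; rewrite /u ap ap'.
have M0 : M (fun=> 0) by have [[_ + _ _ _] _ _ _] := hM.
have [k2 k2P] : exists k : R[i], forall x, v x = k *: p x.
  apply: minimal_projection_selfadjoint => //.
  - apply: vn_scaleD => //; rewrite (_ : (fun x => _) = (fun x => 'i *: a' x + 0)).
      exact: vn_scaleD.
    by apply/funext => x; rewrite addr0.
  - move=> x y; rewrite /v hdotDl hdotDr !hdotZl !hdotZr aa' a'a addrC.
    by congr (_ * _ + _ * _); rewrite ?rmorphN /= conjCi ?opprK.
  - by move=> x; rewrite /v lp (linear_opZ _ _ lp) pa pa'.
  - by move=> x; rewrite /v ap ap'.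
exists ((k1 + 'i * k2) / 2) => x.
have iv : 'i *: v x = a x - a' x.
  by rewrite /v scalerDr !scalerA mulrN -expr2 sqrCi opprK scale1r scaleN1r.
rewrite mulrC -scalerA scalerDl -scalerA -k1P -k2P iv /u scale1r.
rewrite addrACA subrr addr0 -mulr2n -[a x *+ 2]scaler_nat scalerA.
by rewrite mulVf ?scale1r// pnatr_eq0.
Qed.

End VonNeumannAlgebraTheory.

(** * Orthogonal sequences and finite-dimensional corners *)

Section OrthogonalSequences.
Context {R : realType} {H : hilbertType R}.
Variables (M : set (H -> H)) (hM : von_neumann_algebra M).
Implicit Types (x y z : H) (L : set H) (a b e : H -> H).

(** Lying under [e] is encoded on the right, as [p n \o e = p n], to clash with the relation
    [a \o e = 0] known when [T \o a] is bounded. *)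
Definition orthogonal_sequence e (p : nat -> H -> H) : Prop :=
  [/\ forall n, M (p n), forall n x, p n (p n x) = p n x,
      forall n m x, n != m -> p n (p m x) = 0,
      forall n x, p n (e x) = p n x & forall n, exists x, p n x <> 0].

(* A counterexample to the induction would start an infinite strictly
   decreasing chain, whose successive differences are orthogonal. *)
Lemma projection_induction e (F : (H -> H) -> Prop) :
  ~ (exists p, orthogonal_sequence e p) ->
  (forall p, M p -> projection p -> subprojection p e ->
    (forall r, M r -> projection r -> subprojection r p -> r <> p -> F r) -> F p) ->
  projection e -> forall p, M p -> projection p -> subprojection p e -> F p.
Proof.
move=> noseq IH pe p0 Mp0 pp0 p0e; apply: contrapT => nF; apply: noseq.
pose bad p := [/\ M p, projection p, subprojection p e & ~ F p].
have /choice[f fP] : forall p, exists r, bad p -> [/\ bad r, subprojection r p & r <> p].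
  move=> p; have [[Mp pp pe' nFp]|] := pselect (bad p); last by exists p.
  apply: contrapT => nr; apply: nFp; apply: IH => // r Mr pr rp rnp.
  apply: contrapT => nFr; apply: nr; exists r => _; split=> //; split=> //.
  exact: subprojection_trans pe'.
pose p n := iter n f p0.
have bp n : bad (p n) by elim: n => [//|n IHn] /=; have [] := fP _ IHn.
have Mp n : M (p n) by have [] := bp n.
have pp n : projection (p n) by have [] := bp n.
have pS n : subprojection (p n.+1) (p n) by have [] := fP _ (bp n).
have pD n m : subprojection (p (n + m)%N) (p n).
  elim: m => [|m IHm]; first by rewrite addn0; apply/funext => x /=; rewrite projectionK.
  by rewrite addnS; apply: subprojection_trans (pS _) IHm.
have le n m : (n <= m)%N -> subprojection (p m) (p n) by move=> /subnKC <-.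
have leE n m x : (n <= m)%N -> p n (p m x) = p m x.
  by move=> /le nm; exact: subprojectionE.
have geE n m x : (m <= n)%N -> p n (p m x) = p n x.
  by move=> /le nm; exact: subprojectionEr.
have lp n := vn_linear hM (Mp n).
exists (fun n x => p n x - p n.+1 x); split=> [n|n x|n m x|n x|n].
- exact: vnB.
- by rewrite !(linear_opB _ _ (lp _)) (leE n n)// (leE n n.+1)// (leE n.+1 n.+1)// geE// subrr subr0.
- rewrite neq_ltn !(linear_opB _ _ (lp _)) => /orP[nm|mn].
    rewrite (leE n m _ (ltnW nm)) (leE n m.+1 _ (leqW (ltnW nm))).
    by rewrite (leE n.+1 m _ nm) (leE n.+1 m.+1 _ (leqW nm)) subrr.
  rewrite (geE n m _ (ltnW mn)) (geE n m.+1 _ mn).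
  by rewrite (geE n.+1 m _ (leqW (ltnW mn))) (geE n.+1 m.+1 _ (leqW mn)) !subrr.
- by have [_ _ pne _] := bp n; have [_ _ pne' _] := bp n.+1;
    rewrite (subprojectionEr _ (pp n) pe pne) (subprojectionEr _ (pp n.+1) pe pne').
- apply/existsNP => d0; have [_ _] := fP _ (bp n); apply; apply/funext => x.
  by apply/esym/subr0_eq/d0.
Qed.

(** Containment in the span of a finite list, the span being the intersection of all subspaces
    through the list. *)
Definition finite_dimensional (A : set H) : Prop :=
  exists s : seq H, forall L, subspace L -> (forall x, x \in s -> L x) -> A `<=` L.

Lemma finite_dimensional_add (A B C : set H) :
  finite_dimensional A -> finite_dimensional B ->
  (forall x, C x -> exists y z, [/\ A y, B z & x = y + z]) -> finite_dimensional C.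
Proof.
move=> [s sA] [t tB] CAB; exists (s ++ t) => L sL stL x /CAB[y [z [Ay Bz ->]]].
apply: (subspaceD sL); [apply: (sA L)|apply: (tB L)] => // u us;
  by apply: stL; rewrite mem_cat us ?orbT.
Qed.

Lemma minimal_projection_or_split p : M p -> projection p -> minimal_projection M p \/
  exists r s, [/\ M r /\ M s, projection r /\ projection s,
    subprojection r p /\ subprojection s p, r <> p /\ s <> p &
    forall x, p x = r x + s x].
Proof.
move=> Mp pp; have [|/existsNP[r]] := pselect (minimal_projection M p); first by left.
move=> /not_implyP[Mr /not_implyP[pr /not_implyP[rp /not_orP[r0 rnp]]]].
right; exists r, (fun x => p x - r x); have [ps sp] := subprojectionB pr pp rp.
split; [split=> //; exact: vnB|by []|by []|split=> // sE|by move=> x; rewrite addrC subrK].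
apply: r0 => x; have /(congr1 (@^~ x))/eqP := sE.
by rewrite /= subr_eq addrC -subr_eq subrr => /eqP.
Qed.

(** Projection induction on [q], then on [p], reduces to both being minimal. In that case any
    nonzero [p a q] spans all the operators [p b q]. *)
Lemma corner_finite_dimensional e (eta : H) :
  ~ (exists p, orthogonal_sequence e p) -> projection e ->
  forall q, M q -> projection q -> subprojection q e ->
  forall p, M p -> projection p -> subprojection p e ->
  finite_dimensional [set p (a (q eta)) | a in M].
Proof.
move=> noseq pe.
apply: (projection_induction noseq _ pe) => q Mq pq qe IHq.
have [mq|[q1 [q2 [[M1 M2] [P1 P2] [s1 s2] [n1 n2] qE]]]] :=
  minimal_projection_or_split Mq pq; last first.
  move=> p Mp pp pe'; apply: finite_dimensional_add (IHq q1 _ _ _ _ p _ _ _)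
    (IHq q2 _ _ _ _ p _ _ _) _ => //.
  move=> _ [a Ma <-]; exists (p (a (q1 eta))), (p (a (q2 eta))); split; [by exists a|by exists a|].
  by rewrite qE (linear_opD _ _ (vn_linear hM Ma)) (linear_opD _ _ (vn_linear hM Mp)).
apply: (projection_induction noseq _ pe) => p Mp pp pe' IHp.
have [mp|[p1 [p2 [[M1 M2] [P1 P2] [s1 s2] [n1 n2] pE]]]] :=
  minimal_projection_or_split Mp pp; last first.
  apply: finite_dimensional_add (IHp p1 _ _ _ _) (IHp p2 _ _ _ _) _ => //.
  move=> _ [a Ma <-]; exists (p1 (a (q eta))), (p2 (a (q eta))).
  by split; [exists a|exists a|exact: pE].
have [a0|/existsNP[a /not_implyP[Ma /existsNP[x1 ax1]]]] :=
    pselect (forall a, M a -> forall x, p (a (q x)) = 0).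
  by exists [::] => L sL _ _ [a Ma <-]; rewrite a0//; exact: sL.1.
have lp := vn_linear hM Mp; have lq := vn_linear hM Mq.
have [a' Ma' aa'] := vn_adjoint hM Ma.
have [_ _ sp] := pp; have [_ _ sq] := pq.
(* The corner at [q] is scalar, and [c] is nonzero because [p a q] is. *)
have [c cP] : exists c : R[i], forall x, q (a' (p (a (q x)))) = c *: q x.
  apply: (@minimal_projection_corner _ _ _ hM q (q \o a' \o p \o a \o q)) => //.
  - by repeat apply: (vn_comp hM) => //.
  - by move=> x /=; rewrite projectionK.
  - by move=> x /=; rewrite (projectionK _ pq).
have c0 : c != 0.
  apply/eqP => c0; apply: ax1; apply: hdotxx_eq0.
  by rewrite sp (projectionK _ pp) aa' sq cP c0 scale0r hdot0r.
exists [:: p (a (q eta))] => L sL Ls _ [b Mb <-].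
have lb := vn_linear hM Mb.
(* The corner at [p] is scalar too, and [c (p b q) = p b q a' p a q = d (p a q)]. *)
have [d dP] : exists d : R[i], forall x, p (b (q (a' (p x)))) = d *: p x.
  apply: (@minimal_projection_corner _ _ _ hM p (p \o b \o q \o a' \o p)) => //.
  - by repeat apply: (vn_comp hM) => //.
  - by move=> x /=; rewrite projectionK.
  - by move=> x /=; rewrite (projectionK _ pp).
have -> : p (b (q eta)) = (c^-1 * d) *: p (a (q eta)).
  rewrite -[in RHS](projectionK _ pp) -scalerA -dP (projectionK _ pp).
  have -> : q (a' (p (a (q eta)))) = c *: q eta by exact: cP.
  by rewrite (linear_opZ _ _ lb) (linear_opZ _ _ lp) scalerA mulVf// scale1r.
by apply: subspaceZ => //; apply: Ls; rewrite mem_seq1.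
Qed.

(** On the range of [e], [v] is an isometry onto the smaller range of [q]. With [d = e - q], the
    translates [v^n d w^n] project onto the successive wandering subspaces of this shift. *)
Lemma infinite_projection_sequence e : M e -> projection e -> ~ finite_projection M e ->
  exists p, orthogonal_sequence e p.
Proof.
move=> Me pe /existsNP[q /not_implyP[Mq /not_implyP[pq /not_implyP[qe
  /not_implyP[[v [w [Mv Mw vw eE qE]]] qne]]]]].
have le := vn_linear hM Me; have lv := vn_linear hM Mv; have lw := vn_linear hM Mw.
have [_ _ se] := pe; have wv := adjoint_sym vw.
have wvE x : w (v x) = e x by rewrite eE.
have ve x : v (e x) = v x.
  apply/esym/subr0_eq/hdotxx_eq0; rewrite -(linear_opB _ _ lv) vw wvE.
  by rewrite (linear_opB _ _ le) (projectionK _ pe) subrr hdot0r.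
have qv x : q (v x) = v x by rewrite qE /= wvE ve.
have ev x : e (v x) = v x by rewrite -qv (subprojectionE _ qe).
have we x : w (e x) = w x by apply: hdot_injr => z; rewrite -!vw -se ev.
have [pd de] := subprojectionB pq pe qe; set d := (fun x => e x - q x) in pd de.
have Md : M d by exact: vnB.
have ld := vn_linear hM Md; have [_ _ sd] := pd.
have dv x : d (v x) = 0 by rewrite /d ev qv subrr.
have wd x : w (d x) = 0 by apply: hdot_injr => z; rewrite -vw -sd dv hdot0l hdot0r.
have ed x : e (d x) = d x by exact: subprojectionE.
have dE x : d (e x) = d x by exact: subprojectionEr.
have Miter u n : M u -> M (iter n u).
  move=> Mu; elim: n => [|n IHn]; first by have [_ + _ _] := hM.
  by rewrite (_ : iter n.+1 u = u \o iter n u)//; exact: vn_comp.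
have iter0 (u : H -> H) n : linear u -> iter n u 0 = 0.
  by move=> lu; elim: n => //= n ->; rewrite (linear_op0 lu).
have evn n x : e x = x -> e (iter n v x) = iter n v x.
  by case: n => [//|n] _; rewrite iterS ev.
have wvn n x : e x = x -> iter n w (iter n v x) = x.
  by move=> ex; elim: n => // n IHn; rewrite iterSr /= wvE evn.
exists (fun n x => iter n v (d (iter n w x))); split=> [n|n x|n m x|n x|n].
- rewrite (_ : (fun x => _) = iter n v \o d \o iter n w)//.
  by repeat apply: (vn_comp hM) => //; exact: Miter.
- by rewrite wvn// (projectionK _ pd).
(* After [w] cancels [v], the product contains [d \o v] or [w \o d], both zero. *)
- rewrite neq_ltn => /orP[/subnKC|/subnKC] <-.
    rewrite addSnnS iterD wvn; last exact: evn.
    by rewrite iterS dv; exact: iter0 lv.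
  rewrite addSnnS addnC [iter (_ + _) w _]iterD wvn// iterSr wd.
  by rewrite (iter0 w)// (linear_op0 ld); exact: iter0 lv.
- by case: n => [|n]; rewrite ?iterSr ?we//= dE.
(* Testing on [iter n v (d x)] and cancelling [v] would give [d = 0], that is [q = e]. *)
- apply/existsNP => p0; apply: qne; apply/funext => x; apply/esym/subr0_eq.
  have := p0 (iter n v (d x)); rewrite /= (wvn _ _ (ed x)) (projectionK _ pd).
  by move=> /(congr1 (iter n w)); rewrite (wvn _ _ (ed x)) (iter0 w).
Qed.

(** The hypothesis allows choosing each [z n] under [e] and orthogonal to [M] applied to its
    predecessors. The cyclic subspaces of the [z n] are then mutually orthogonal and [M]-invariant,
    so their projections lie in the commutant. *)
Lemma commutant_orthogonal_sequence e : M e -> commutant M e -> projection e ->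
  (forall s : seq H, exists z, [/\ e z = z, z <> 0 &
     forall y a, y \in s -> M a -> hdot z (a y) = 0]) ->
  exists p : nat -> H -> H, [/\ forall n, commutant M (p n),
    forall n x, p n (p n x) = p n x, forall n m x, n != m -> p n (p m x) = 0,
    forall n x, e (p n x) = p n x & forall n, exists x, p n x <> 0].
Proof.
move=> Me Me' pe /choice[f fP]; have [_ _ se] := pe.
pose fix s n := if n is m.+1 then f (s m) :: s m else [::].
pose z n := f (s n).
have zs m n : (m < n)%N -> z m \in s n.
  elim: n => // n IHn; rewrite ltnS leq_eqVlt => /orP[/eqP ->|/IHn mn] /=.
    exact: mem_head.
  by rewrite in_cons mn orbT.
have zP n : e (z n) = z n /\ z n <> 0 by have [] := fP (s n).
have zz n m a : n != m -> M a -> hdot (z n) (a (z m)) = 0.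
  rewrite neq_ltn => /orP[nm|mn] Ma; last first.
    by have [_ _] := fP (s n); apply=> //; exact: zs.
  have [a' Ma' aa'] := vn_adjoint hM Ma; rewrite -(adjoint_sym aa').
  by apply: hdotC0; have [_ _] := fP (s m); apply=> //; exact: zs.
(* [L n], the double orthogonal of the orbit of [z n] under [M], is the closed cyclic subspace. *)
pose S n := [set y | forall a, M a -> hdot (a (z n)) y = 0].
pose L n := [set x | forall y, S n y -> hdot x y = 0].
have /choice[p pP] : forall n, exists p, commutant M p /\ proj_onto p (L n).
  move=> n; have [a x Ma Lx y Sy|p Mp pL] :=
    @commutant_proj_onto _ _ _ hM (L n) (closed_subspace_ortho (S n)); last by exists p.
  have [a' Ma' aa'] := vn_adjoint hM Ma; rewrite aa'; apply: Lx => b Mb.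
  by rewrite -aa'; exact: Sy (vn_comp hM Ma Mb).
have Lp n x : L n (p n x) by have [_ []] := pP n.
have LL n m x y : n != m -> L n x -> L m y -> hdot x y = 0.
  move=> nm Lx Ly; apply: Lx => a Ma; apply: hdotC0; apply: Ly => b Mb.
  have [b' Mb' bb'] := vn_adjoint hM Mb; rewrite bb'.
  by apply: (zz _ _ (b' \o a)); [rewrite eq_sym|exact: vn_comp].
exists p; split=> [n|n x|n m x nm|n x|n]; have [Mp [pp _ pL]] := pP n.
- by [].
- exact: projectionK.
- have [_ _ sp] := pp; apply: hdot_inj => y.
  by rewrite sp hdot0l; apply: LL (Lp _ _) (Lp _ _); rewrite eq_sym.
- have : hdot (p n x) (p n x - e (p n x)) = 0.
    apply: Lp => a Ma; by rewrite hdotBr -se -(commutantE _ Ma Me') (zP n).1 subrr.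
  move=> h0; apply/esym/subr0_eq/hdotxx_eq0.
  by rewrite hdotBl h0 se (linear_opB _ _ Me'.1.1) (projectionK _ pe) subrr hdot0r subrr.
- exists (z n); rewrite pL; first exact: (zP n).2.
  by move=> y Sy; apply: (Sy idfun); have [_ + _ _] := hM.
Qed.

(** Conjugation by [J] carries a sequence of the commutant into [M], and it stays under [e] because
    [J] commutes with the self-adjoint central [e]. *)
Lemma standard_orthogonal_sequence e : standard M -> M e -> commutant M e -> projection e ->
  (forall s : seq H, exists z, [/\ e z = z, z <> 0 &
     forall y a, y \in s -> M a -> hdot z (a y) = 0]) ->
  exists p, orthogonal_sequence e p.
Proof.
move=> [J [[_ _ aJ JJ] [JM Jz]]] Me Me' pe sP; have [_ _ se] := pe.
have [p [Mp pp pq ep pn]] := commutant_orthogonal_sequence Me Me' pe sP.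
have J0 : J 0 = 0.
  have := aJ 1 0 0; rewrite scale1r rmorph1 scale1r addr0 => /eqP.
  by rewrite -subr_eq subrr => /eqP.
have Je x : J (e x) = e (J x).
  apply: hdot_injr => y; rewrite -se (Jz e _ _ _)/= ?JJ//.
exists (fun n => J \o p n \o J); split=> [n|n x|n m x nm|n x|n] /=.
- have : commutant M (p n) by [].
  rewrite -JM => -[a Ma <-]; rewrite (_ : J \o _ \o J = a)//.
  by apply/funext => x /=; rewrite !JJ.
- by rewrite JJ pp.
- by rewrite JJ pq.
- by rewrite Je -(commutantE _ Me (Mp n)) ep.
- have [x px] := pn n; exists (J x) => /(congr1 J); rewrite !JJ J0.
  exact: px.
Qed.

End OrthogonalSequences.

(** * The part of [M] on which [T] is unbounded *)

Section Intertwiner.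
Context {R : realType} {H : hilbertType R} {X : completeNormedModType R[i]}.
Variables (M : set (H -> H)) (T : H -> X) (Tinv : X -> H).
Hypotheses (hM : von_neumann_algebra M) (lT : linear T).
Hypotheses (TK : cancel T Tinv) (TinvK : cancel Tinv T).
Hypothesis bT : forall a, M a -> bounded_op (T \o a \o Tinv).
Implicit Types (x y z : H) (a b e : H -> H).

Lemma intertwiner_inj x : T x = 0 -> x = 0.
Proof. by rewrite -{2}(TK x) => ->; rewrite -(linear_op0 lT) TK. Qed.

(* [e] projects onto the joint kernel of the [a] in [M] with [T a] bounded,
   which contains the preimage of the separating space of [T]. *)
Lemma unbounded_part : exists e, [/\ M e, commutant M e, projection e,
  forall a, M a -> bounded_op (T \o a) -> forall x, a (e x) = 0 &
  (forall x, e x = 0) -> bounded_op T].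
Proof.
pose I a := M a /\ bounded_op (T \o a).
pose L := [set x | forall a, I a -> a x = 0].
have cL : closed_subspace L.
  split.
    split; first by move=> a [Ma _]; exact: linear_op0 (vn_linear hM Ma).
    by move=> k x y Lx Ly a Ia; rewrite (vn_linear hM Ia.1) Lx// Ly// scaler0 addr0.
  move=> x xP a Ia; apply: (closed_subspace_ker (vn_bounded hM Ia.1)).2 => u /xP[y Ly xy].
  by exists y => //; exact: Ly.
have LM b x : commutant M b -> L x -> L (b x).
  move=> Mb Lx a Ia; rewrite (commutantE _ Ia.1 Mb) Lx//.
  exact: linear_op0 Mb.1.1.
have [e Me eL] := vn_proj_onto hM cL LM; have [pe Le eE] := eL.
(* The elements defining [L] are stable under right multiplication by [M]; this second invariance
   puts [e] in the commutant as well. *)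
have LM' a x : M a -> L x -> L (a x).
  move=> Ma Lx b [Mb bb]; apply: (Lx (b \o a)); split; first exact: vn_comp.
  exact: (bounded_op_comp bb (vn_bounded hM Ma)).
exists e; split=> //.
- split=> [|a Ma]; first exact: vn_bounded Me.
  have [a' Ma' aa'] := vn_adjoint hM Ma; apply/funext => x /=; apply/esym.
  by apply: (proj_onto_commute eL (vn_linear hM Ma) aa') => y; exact: LM'.
- by move=> a Ma ba x; exact: Le.
- move=> e0; apply: closed_graph lT _ => u l u0 ul.
  (* [T (a (u n))] tends to [0] when [T \o a] is bounded, and to [T (a (Tinv l))] because
     [T \o a \o Tinv] is bounded. *)
  have : L (Tinv l).
    move=> a [Ma ba]; apply: intertwiner_inj.
    apply: (@cvto_uniq _ _ (T \o a \o u)).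
      have := bounded_op_cvto (bT Ma) ul; congr (cvto _ _).
      by apply/funext => n /=; rewrite TK.
    by have := bounded_op_cvto ba u0; rewrite (linear_op0 ba.1).
  by move=> /eE; rewrite e0 => l0; rewrite -(TinvK l) -l0 (linear_op0 lT).
Qed.

(** The gliding hump makes some [T \o p n] bounded, so [p n = p n \o e] vanishes. *)
Lemma no_orthogonal_sequence e :
  (forall a, M a -> bounded_op (T \o a) -> forall x, a (e x) = 0) ->
  ~ exists p, orthogonal_sequence M e p.
Proof.
move=> eP [p [Mp pp pq pe pn]].
have [n Tn] := @gliding_hump _ _ _ T p (fun n => T \o p n \o Tinv) lT
  (fun n => vn_bounded hM (Mp n)) (fun n => bT (Mp n)) pp pq
  (fun n x => congr1 (T \o p n) (TK x)).
by have [x] := pn n; rewrite -pe eP.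
Qed.

(** The fixed points of [Q] form a closed subspace, so [Q] passes from a finite list to its closed
    span. It is built by rank-one corrections, as in Gram-Schmidt. *)
Lemma finite_rank_retraction (s : seq H) : exists Q : H -> H,
  [/\ bounded_op Q, bounded_op (T \o Q) & forall x, x \in s -> Q x = x].
Proof.
elim: s => [|v s [Q [bQ bTQ Qs]]].
  exists (fun=> 0); split=> //; apply/bounded_opP.
    split; first by move=> k x y; rewrite scaler0 addr0.
    by exists 1 => // x; rewrite nrm0 mul1r nrm_ge0.
  split; first by move=> k x y; rewrite /= (linear_op0 lT) scaler0 addr0.
  by exists 1 => // x; rewrite /= (linear_op0 lT) nrm0 mul1r nrm_ge0.
pose w := v - Q v; have [w0|/eqP w0] := eqVneq w 0.
  exists Q; split=> // x; rewrite inE => /predU1P[->|/Qs//].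
  by apply/esym/subr0_eq.
have lQ := bQ.1.
have ww : hdot w w != 0 by apply/eqP => /hdotxx_eq0.
(* This functional is [1] at [v] and [0] on [s], whose vectors [Q] already fixes. *)
pose f x := hdot (x - Q x) w / hdot w w.
have fb (V : normedModType R[i]) (z : V) : bounded_op (fun x => f x *: z).
  have [_ [c c0 rc]] := (bounded_opP _).1 (bounded_opB (bounded_op_id _) bQ).
  apply/bounded_opP; split.
    move=> k x y; rewrite /f lQ opprD addrACA -scalerBr (hdotDl (k *: _)) hdotZl mulrDl scalerDl.
    by rewrite -mulrA scalerA.
  have K0 : 0 <= complex.Re `|(hdot w w)^-1| * nrm z.
    by rewrite mulr_ge0 ?nrm_ge0// -ler0c RRe_real// normr_real.
  exists (c * nrm w * (complex.Re `|(hdot w w)^-1| * nrm z) + 1).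
    by rewrite ltr_wpDl// mulr_ge0// mulr_ge0 ?nrm_ge0// ltW.
  move=> x; have -> : nrm (f x *: z) =
      complex.Re `|hdot (x - Q x) w| * (complex.Re `|(hdot w w)^-1| * nrm z).
    by rewrite nrmZ mulrA; congr (_ * _); exact: (nrmZ _ (_ : R[i]^o)).
  apply: (@le_trans _ _ (c * nrm x * nrm w * (complex.Re `|(hdot w w)^-1| * nrm z))).
    rewrite ler_wpM2r// (le_trans (normr_hdot_le _ _))// ler_wpM2r ?nrm_ge0//.
    exact: rc.
  by have := nrm_ge0 x; lra.
exists (fun x => 1 *: (f x *: w) + Q x); split.
- exact: bounded_op_scaleD.
- rewrite (_ : T \o _ = fun x => 1 *: (f x *: T w) + (T \o Q) x).
    exact: bounded_op_scaleD.
  by apply/funext => x /=; rewrite lT (linear_opZ _ _ lT).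
- move=> x; rewrite inE => /predU1P[->|/Qs xs].
    by rewrite /f -/w divff// !scale1r subrK.
  by rewrite /f xs subrr hdot0l mul0r scale0r scaler0 add0r.
Qed.

(** The vectors [e (a y)] lie in the span of a finite list [t]; a retraction [Q] fixing [t] then
    fixes the range of [e]. Hence [T \o e = T \o Q \o e] is bounded, so [e = e \o e = 0]. *)
Lemma unbounded_part_eq0 e (s : seq H) : M e -> commutant M e -> projection e ->
  (forall a, M a -> bounded_op (T \o a) -> forall x, a (e x) = 0) ->
  (forall L, closed_subspace L ->
     (forall a y, M a -> y \in s -> L (e (a y))) -> forall x, L (e x)) ->
  forall x, e x = 0.
Proof.
move=> Me Me' pe eP es; have noseq := no_orthogonal_sequence eP.
have le := vn_linear hM Me.
have ee : subprojection e e by apply/funext => x /=; exact: projectionK.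
have [t tP] : exists t : seq H, forall L, subspace L -> (forall x, x \in t -> L x) ->
    forall a y, M a -> y \in s -> L (e (a y)).
  elim: s {es} => [|y s [t tP]]; first by exists [::].
  have [u uP] := corner_finite_dimensional hM y noseq pe Me pe ee Me pe ee.
  exists (u ++ t) => L sL utL a z Ma; rewrite inE => /predU1P[->|zs]; last first.
    by apply: (tP L) => // x xt; apply: utL; rewrite mem_cat xt orbT.
  apply: (uP L) => // [x xu|]; first by apply: utL; rewrite mem_cat xu.
  by exists a => //; rewrite (commutantE _ Ma Me') projectionK.
have [Q [bQ bTQ Qt]] := finite_rank_retraction t.
have cQ := closed_subspace_eq bQ (bounded_op_id _).
have Qe x : Q (e x) = e x by apply: (es _ cQ) => a y Ma ys; exact: (tP _ cQ.1 Qt).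
have bTe : bounded_op (T \o e).
  rewrite (_ : T \o e = (T \o Q) \o e).
    exact: bounded_op_comp bTQ (vn_bounded hM Me).
  by apply/funext => x /=; rewrite Qe.
by move=> x; rewrite -(projectionK _ pe) eP.
Qed.

End Intertwiner.

(** * Boundedness of [T] under each of the three conditions *)

Lemma cyclic_vectorP (R : realType) (H : hilbertType R) (M : set (H -> H)) xi x (d : R) :
  cyclic_vector M xi -> 0 < d -> exists2 a, M a & nrm (x - a xi) < d.
Proof.
move=> cx d0; have d0' : 0 < d%:C :> R[i] by rewrite ltcR.
have [||y [xy [a Ma ay]]] := cx (ball x d%:C).
- by exists x; exact: ballxx.
- exact: ball_open.
- by exists a => //; move: xy; rewrite ay -ball_normE /= nrmE ltcR.
Qed.

Theorem proposition6p1 (R : realType) (H : hilbertType R)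
    (X : completeNormedModType R[i]) (M : set (H -> H))
    (T : {linear H -> X}) (Tinv : X -> H) :
  von_neumann_algebra M ->
  cancel T Tinv -> cancel Tinv T ->
  let TMTinv := [set T \o x \o Tinv | x in M] in
  subalgebra TMTinv -> opnorm_closed TMTinv ->
  (exists xi : H, cyclic_vector M xi) \/ properly_infinite M \/ standard M ->
  bounded_op T.
Proof.
move=> hM TK TinvK TMTinv [bS _ _ _ _] _ hyp.
have lT : linear T by move=> k x y; rewrite linearP.
have bT a : M a -> bounded_op (T \o a \o Tinv) by move=> Ma; apply: bS; exists a.
have [e [Me Me' pe eP]] := unbounded_part hM lT TK TinvK bT; apply.
have noseq := no_orthogonal_sequence hM lT TK bT eP.
have zero := unbounded_part_eq0 hM lT TK bT Me Me' pe eP.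
case: hyp => [[xi cxi]|[infM|stM]].
(* By continuity of [e], the vectors [e (a xi)] approximate every [e x]. *)
- apply: (zero [:: xi]) => L cL Lxi x; apply: cL.2 => d d0.
  have [d' d'0 ed] := bounded_op_near x (vn_bounded hM Me) d0.
  have [a Ma /ed] := cyclic_vectorP x cxi d'0.
  by exists (e (a xi)) => //; apply: Lxi; rewrite ?mem_head.
- apply: contrapT => e0; apply: noseq; apply: infinite_projection_sequence => //.
  apply: infM => // ee; apply: e0 => x; by rewrite ee.
- apply: contrapT => e0; apply: noseq; apply: standard_orthogonal_sequence => // s.
  apply: contrapT => nz; apply: e0; apply: (zero s) => L cL Ls x.
  have [p [pp Lp pL]] := ex_proj_onto cL.
  (* If [e x] were outside [L], then [e u] would be a nonzero vector under [e] orthogonal to all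
     [a y] with [y] in [s]. *)
  pose u := e x - p (e x).
  have [_ _ se] := pe; have [[lp _] _ sp] := pp.
  have uL y : L y -> hdot u y = 0.
    move=> Ly; rewrite -(pL y Ly) -sp /u (linear_opB _ _ lp) (projectionK _ pp).
    by rewrite subrr hdot0l.
  apply: contrapT => nL; apply: nz; exists (e u); split.
  + exact: projectionK.
  + move=> eu0; apply: nL; suff -> : e x = p (e x) by [].
    apply: subr0_eq; apply: hdotxx_eq0; rewrite -/u {2}/u hdotBr (uL _ (Lp _)) subr0.
    by rewrite -se eu0 hdot0l.
  + by move=> y a ys Ma; rewrite se uL//; exact: Ls.
Qed.
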